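(* Let $n\ge2$, let $V_1,\dots,V_n$ be complex vector spaces with $\dim V_i=k_i+1$, $k_i\ge1$, and let $W={\rm Tan}(\mathbb{P}(V_1)\times\dots\times\mathbb{P}(V_n))\cap\{x_{(0,\dots,0)}\ne0\}$. Then $W$ is isomorphic to the trivial affine bundle of rank $\sum_{i=1}^nk_i$ over the spectrum of the semigroup algebra (over $\mathbb{C}$) associated to the monoid generated by the lattice points of $Q$, i.e. $W\cong {\rm Spec}\,\mathbb{C}[\mathbb{N}(Q\cap\mathbb{Z}^{k_1+\dots+k_n})]\times\mathbb{A}^{k_1+\dots+k_n}$.
   Context: Fix bases $e^i_0,\dots,e^i_{k_i}$ of $V_i$ and let $x_{(i_1,\dots,i_n)}$, $0\le i_j\le k_j$, be the corresponding homogeneous coordinates on $\mathbb{P}(V_1\otimes\dots\otimes V_n)$. The Segre variety is the image of $\mathbb{P}(V_1)\times\dots\times\mathbb{P}(V_n)$ under $([v_1],\dots,[v_n])\mapsto[v_1\otimes\dots\otimes v_n]$; its tangential variety ${\rm Tan}$ is the union of all (projective) lines tangent to it. Let $\mathbb{Z}^{k_1}\times\dots\times\mathbb{Z}^{k_n}$ have standard basis $e^i_j$ ($1\le i\le n$, $1\le j\le k_i$). $Q$ is the convex hull of all points $\sum_{j:\,i_j\ne0}e^j_{i_j}$, where $(i_1,\dots,i_n)\in\prod_j\{0,\dots,k_j\}$ has at least two nonzero entries. $\mathbb{N}(\cdot)$ denotes the generated submonoid. *)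

(* Defs.v *)
From HB Require Import structures.
From mathcomp Require Import all_boot all_order all_algebra.
From mathcomp Require Import boolp classical_sets reals.
From mathcomp Require Import complex.
From mathcomp Require Import mpoly.
(* Imported only locally below: it also defines {mpoly C[m]}, differently. *)
From mathcomp Require monalg.

Set Implicit Arguments.
Unset Strict Implicit.
Unset Printing Implicit Defensive.

Import Order.TTheory GRing.Theory Num.Theory.
Local Open Scope classical_set_scope.
Local Open Scope ring_scope.

(* Complex varieties are taken in the classical sense: a set of closed points
   with its Zariski topology and its sheaf of regular functions.  Sections over
   an open set U are represented by functions on the whole space, whose values
   outside U are irrelevant. *)

Structure variety (C : Type) := Variety {
  point :> Type;
  zopen : set (set point);
  regular : set point -> set (point -> C) }.

Definition is_morphism (C : Type) (X Y : variety C) (f : X -> Y) : Prop :=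
  (forall V, zopen V -> zopen (f @^-1` V)) /\
  (forall V h, zopen V -> regular V h -> regular (f @^-1` V) (h \o f)).

Definition isomorphic (C : Type) (X Y : variety C) : Prop :=
  exists (f : X -> Y) (g : Y -> X),
    [/\ is_morphism f, is_morphism g, cancel f g & cancel g f].

(* principal lists the basic open sets D(g); fraction N f says that f is given
   on N by a single admissible fraction with nowhere vanishing denominator. *)
Definition locally_fractional (C X : Type) (principal : set (set X))
    (fraction : set X -> set (X -> C)) : variety C :=
  let op := [set U | exists2 S, S `<=` principal & U = \bigcup_(D in S) D] in
  {| point := X;
     zopen := op;
     regular := fun U f => forall x, U x ->
       exists N, [/\ op N, N x, N `<=` U & fraction N f] |}.

Section Affine.
Variable C : fieldType.

(* An affine variety, presented by its points and its coordinate ring, seen as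
   a ring of functions on the points. *)
Structure affine := Affine {
  affine_point : Type;
  coordinate : set (affine_point -> C) }.

Definition affine_variety (X : affine) : variety C :=
  @locally_fractional C (affine_point X)
    [set D | exists2 g, coordinate g & D = [set x | g x != 0]]
    (fun N f => exists g h, [/\ coordinate g, coordinate h &
       forall x, N x -> h x != 0 /\ f x = g x / h x]).

(* The points are the C-points; for C algebraically closed and A finitely
   generated these are the maximal ideals of A. *)
Definition Spec (A : comAlgType C) : affine := {|
  affine_point := {lrmorphism A -> C^o};
  coordinate := [set f | exists a : A, f = fun phi : {lrmorphism A -> C^o} => phi a] |}.

Definition affine_space (m : nat) : affine := {|
  affine_point := {ffun 'I_m -> C};
  coordinate := [set f | exists F : {mpoly C[m]}, f = fun x : {ffun 'I_m -> C} => F.@[x]] |}.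

(* The coordinate ring of a product is the tensor product. *)
Definition affine_prod (X Y : affine) : affine := {|
  affine_point := affine_point X * affine_point Y;
  coordinate := [set f | exists (r : nat)
      (g : 'I_r -> affine_point X -> C) (h : 'I_r -> affine_point Y -> C),
      [/\ forall j, coordinate (g j), forall j, coordinate (h j) &
          f = fun z => \sum_(j < r) g j z.1 * h j z.2]] |}.

End Affine.

Section Projective.
Variables (C : fieldType) (T : finType).

(* The vector space with coordinates x_t, t : T.  Points of its projective space
   are the subspaces of dimension 1, lines those of dimension 2. *)
Local Notation E := {ffun T -> C^o}.

(* The variable of index j stands for the coordinate x_(enum_val j). *)
Definition peval (F : {mpoly C[#|T|]}) (v : E) : C :=
  F.@[fun j => v (enum_val j)].

Definition directional_derivative (F : {mpoly C[#|T|]}) (v w : E) : C :=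
  \sum_(j < #|T|) w (enum_val j) * peval F^`M(j) v.

(* Only meant for locally closed X; X is given the reduced structure. *)
Definition quasi_projective (X : set {vspace E}) : variety C :=
  @locally_fractional C {p : {vspace E} | \dim p = 1%N /\ X p}
    [set D | exists d, exists2 G : {mpoly C[#|T|]}, G \is d.-homog &
       D = [set p | forall v, <[v]>%VS = sval p -> peval G v != 0]]
    (fun N f => exists d (F G : {mpoly C[#|T|]}),
       [/\ F \is d.-homog, G \is d.-homog &
        forall p v, N p -> <[v]>%VS = sval p ->
          peval G v != 0 /\ f p = peval F v / peval G v]).

Definition vanishes_on (X : set {vspace E}) (F : {mpoly C[#|T|]}) : Prop :=
  forall v, v != 0 -> X <[v]>%VS -> peval F v = 0.

(* A line L through p in X is tangent to X at p when it lies in the embedded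
   tangent space, cut out by the differentials at p of the homogeneous
   equations of X. *)
Definition tangent_line (X : set {vspace E}) (p L : {vspace E}) : Prop :=
  [/\ \dim p = 1%N /\ X p, \dim L = 2%N, (p <= L)%VS &
      forall d (F : {mpoly C[#|T|]}), F \is d.-homog -> vanishes_on X F ->
        forall v w, v \in p -> w \in L -> directional_derivative F v w = 0].

Definition tangential_variety (X : set {vspace E}) : set {vspace E} :=
  [set x | \dim x = 1%N /\
           exists p L, tangent_line X p L /\ (x <= L)%VS].

Definition chart (t : T) : set {vspace E} :=
  [set x | forall v : E, <[v]>%VS = x -> v t != 0].

End Projective.

Section Segre.
Variables (C : fieldType) (n : nat) (k : 'I_n -> nat).
Variable V : 'I_n -> vectType C.
Variable e : forall i, (k i).+1.-tuple (V i).

(* Multi-indices (i_1, ..., i_n), 0 <= i_j <= k_j. *)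
Definition multi_index := {dffun forall i : 'I_n, 'I_(k i).+1}.

Definition multi_index0 : multi_index := [ffun i => ord0].

(* v_1 (x) ... (x) v_n, written in the basis of the tensor product of the V_i
   made of the tensor products of the vectors of the bases e i. *)
Definition pure_tensor (v : forall i, V i) : {ffun multi_index -> C^o} :=
  [ffun I : multi_index => \prod_(i < n) coord (e i) (I i) (v i)].

Definition segre : set {vspace {ffun multi_index -> C^o}} :=
  [set p | exists2 v : forall i, V i,
     forall i, v i != 0 & p = <[pure_tensor v]>%VS].

End Segre.

Section Polytope.
Import monalg.
Variables (R : realType) (n : nat) (k : 'I_n -> nat).

Definition convex_hull (W : lmodType R) (S : set W) : set W :=
  [set x | exists (r : nat) (p : 'I_r -> W) (w : 'I_r -> R),
     [/\ forall j, S (p j), forall j, 0 <= w j, \sum_(j < r) w j = 1 &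
         x = \sum_(j < r) w j *: p j]].

(* Index set of the basis vectors e^i_j, 1 <= i <= n, 1 <= j <= k_i; the
   number j is represented by the ordinal j - 1. *)
Definition basis_index := {i : 'I_n & 'I_(k i)}.

(* The sum of the e^j_(i_j) over those j with i_j <> 0, for the multi-index I:
   its coordinate along e^i_j is 1 if I i = j and 0 otherwise. *)
Definition vertex (I : multi_index k) : {ffun basis_index -> R^o} :=
  [ffun b : basis_index => (I (tag b) == lift ord0 (tagged b))%:R].

Definition Q : set {ffun basis_index -> R^o} :=
  convex_hull
    (vertex @` [set I : multi_index k |
                 (2 <= #|[pred i : 'I_n | I i != ord0]|)%N]).

Definition lattice_points : set {ffun basis_index -> int} :=
  [set z | Q [ffun b => (z b)%:~R]].

Definition generated_submonoid (Z : zmodType) (S : set Z) : set Z :=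
  smallest [set H | H 0 /\ forall x y, H x -> H y -> H (x + y)] S.

Definition Q_monoid :=
  {z : {ffun basis_index -> int} | z \in generated_submonoid lattice_points}.

HB.instance Definition _ := Choice.on Q_monoid.

Lemma generated_submonoid0 (Z : zmodType) (S : set Z) :
  0 \in generated_submonoid S.
Proof. by rewrite inE => H [[]]. Qed.

Lemma generated_submonoidD (Z : zmodType) (S : set Z) (x y : Z) :
  x \in generated_submonoid S -> y \in generated_submonoid S ->
  x + y \in generated_submonoid S.
Proof.
rewrite !inE => Sx Sy H HS; have [[_ HD] _] := HS.
by apply: HD; [apply: Sx | apply: Sy].
Qed.

Definition Q_monoid_zero : Q_monoid :=
  exist _ 0 (generated_submonoid0 lattice_points).

Definition Q_monoid_add (x y : Q_monoid) : Q_monoid :=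
  exist _ (sval x + sval y) (generated_submonoidD (svalP x) (svalP y)).

Lemma Q_monoid_addA : associative Q_monoid_add.
Proof. by move=> x y z; apply: val_inj; rewrite /= addrA. Qed.

Lemma Q_monoid_addC : commutative Q_monoid_add.
Proof. by move=> x y; apply: val_inj; rewrite /= addrC. Qed.

Lemma Q_monoid_add0 : left_id Q_monoid_zero Q_monoid_add.
Proof. by move=> x; apply: val_inj; rewrite /= add0r. Qed.

Lemma Q_monoid_addr0 : right_id Q_monoid_zero Q_monoid_add.
Proof. by move=> x; rewrite Q_monoid_addC Q_monoid_add0. Qed.

Lemma lattice_points_ge0 z : lattice_points z -> forall b, 0 <= z b.
Proof.
move=> [r [p [w [Sp w0 _ E]]]] b.
have := congr1 (fun f : {ffun basis_index -> R^o} => f b) E.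
rewrite ffunE sum_ffunE => Eb.
suff: 0 <= ((z b)%:~R : R) by rewrite ler0z.
rewrite [X in 0 <= X]Eb; apply: sumr_ge0 => j _.
have [I _ pE] := Sp j.
by rewrite ffunE -pE ffunE; apply: mulr_ge0.
Qed.

Lemma Q_monoid_ge0 (x : Q_monoid) b : 0 <= sval x b.
Proof.
have := svalP x; rewrite inE.
move=> /(_ [set z : {ffun basis_index -> int} | forall b, 0 <= z b]); apply.
split; last exact: lattice_points_ge0.
split=> [c|y z y0 z0 c]; first by rewrite ffunE.
by rewrite ffunE addr_ge0.
Qed.

Lemma Q_monoid_pointed x y : Q_monoid_add x y = Q_monoid_zero ->
  x = Q_monoid_zero /\ y = Q_monoid_zero.
Proof.
move=> /(congr1 sval) /= xy0.
have xy b : sval x b = 0 /\ sval y b = 0.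
  have /eqP := congr1 (fun f : {ffun basis_index -> int} => f b) xy0.
  rewrite !ffunE paddr_eq0 ?Q_monoid_ge0 //.
  by move=> /andP[/eqP-> /eqP->].
by split; apply: val_inj; apply/ffunP => b; rewrite ffunE; have [] := xy b.
Qed.

HB.instance Definition _ := Choice_isMonomialDef.Build Q_monoid
  Q_monoid_addA Q_monoid_add0 Q_monoid_addr0 Q_monoid_pointed.
HB.instance Definition _ := MonomialDef_isConomialDef.Build Q_monoid
  Q_monoid_addC.

Definition Q_algebra : comAlgType R[i] := {malg R[i][Q_monoid]}.

End Polytope.

(* Main.v *)
Require Import Defs.
From HB Require Import structures.
From mathcomp Require Import all_boot all_order all_algebra.
From mathcomp Require Import boolp classical_sets reals complex.
From mathcomp Require Import mpoly ring zify.

(* A point of W is a tangent vector sum_i a_1 (x) .. (x) b_i (x) .. (x) a_n of the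
   Segre variety with coordinate 1 at (0,...,0).  Translating every tensor factor
   by the coordinates x_(0,..,i_j,..,0) (passing to cumulants) turns it into a
   tangent vector z whose coordinates with exactly one nonzero index vanish;
   those coordinates are the affine space factor.  If no a_i vanishes at 0, then
   z_I = (1 - |I|) prod_(I_i <> 0) c_i(I_i), where |I| is the number of nonzero
   indices; if a_s vanishes at 0, the same holds with the product replaced by 0
   unless |I| = 2 and I_s <> 0.  So z_I / (1 - |I|) is the value of a monoid
   morphism on the vertex of Q given by I, supported on the whole cone or on the
   face of the star of s.  Conversely, a monoid morphism nonzero on some vertex
   with |I| >= 3 is of the first kind; otherwise the supports of the vertices on
   which it is nonzero are pairs that meet pairwise and contain no triangle, hence
   share an element s, and it is of the second kind. *)

Set Implicit Arguments.
Unset Strict Implicit.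
Unset Printing Implicit Defensive.

Import Order.TTheory GRing.Theory Num.Theory.
Local Open Scope ring_scope.

(** * Tangent vectors and shears *)

Section Tensors.
Variables (C : fieldType) (n : nat) (k : 'I_n -> nat).
Local Notation MI := (multi_index k).
Local Notation E := {ffun MI -> C^o}.
Local Notation family := (forall i, 'I_(k i).+1 -> C).
Implicit Types (I J K : MI) (a b y : family) (u z : E).

Definition upd I i (j : 'I_(k i).+1) : MI := [ffun l => dfwith I j l].

Lemma upd_in I i (j : 'I_(k i).+1) : upd I j i = j.
Proof. by rewrite ffunE dfwith_in. Qed.

Lemma upd_out I i (j : 'I_(k i).+1) l : i != l -> upd I j l = I l.
Proof. by move=> il; rewrite ffunE dfwith_out. Qed.

Lemma upd_id I i : upd I (I i) = I.
Proof.
apply/ffunP => l; have [<-|il] := eqVneq i l; first by rewrite upd_in.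
by rewrite upd_out.
Qed.

Definition decomposable a : E := [ffun I : MI => \prod_i a i (I i) : C].

(** The derivative at [a], in the direction [b], of the multilinear map [decomposable]. *)
Definition tangent_vector a b : E := \sum_i decomposable (dfwith a (b i)).

Lemma tangent_vectorE a b I : tangent_vector a b I =
  \sum_i b i (I i) * \prod_(l < n | l != i) a l (I l) :> C.
Proof.
rewrite sum_ffunE; apply: eq_bigr => i _.
rewrite ffunE (bigD1 i) //= dfwith_in; congr (_ * _).
by apply: eq_bigr => l li; rewrite dfwith_out // eq_sym.
Qed.

Definition cutoff (S : {set 'I_n}) I : MI :=
  [ffun i => if i \in S then ord0 else I i].

(** The value at [ord0] is forced to 0, so that in [shear] only sets [S] of nonzero indices of [I]
    contribute. *)
Definition offzero y : family := fun i j => if j == ord0 then 0 else y i j.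

(* The substitution e^i_0 |-> e^i_0 + sum_j y^i_j e^i_j in every tensor factor. *)
Definition shear y u : E := [ffun I : MI =>
  \sum_(S : {set 'I_n}) (\prod_(i in S) offzero y (I i)) * u (cutoff S I) : C].

(** Distributing the product over the tensor factors gives one term for each set [S] of factors in
    which the first summand is taken. *)
Lemma shear_decomposable y a : shear y (decomposable a) =
  decomposable (fun i j => offzero y j * a i ord0 + a i j).
Proof.
apply/ffunP => I; rewrite !ffunE bigA_distr /=.
apply: eq_bigr => S _; rewrite ffunE [in LHS]big_mkcond -big_split /=.
by apply: eq_bigr => i _; rewrite ffunE; case: ifP => _; rewrite ?mul1r.
Qed.

Lemma shear_sum y (T : Type) (r : seq T) (F : T -> E) :
  shear y (\sum_(t <- r) F t) = \sum_(t <- r) shear y (F t).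
Proof.
apply/ffunP => I; rewrite ffunE sum_ffunE.
under [RHS]eq_bigr do rewrite ffunE.
rewrite exchange_big /=; apply: eq_bigr => S _.
by rewrite sum_ffunE mulr_sumr.
Qed.

Lemma shearZ y (c : C) u : shear y (c *: u) = c *: shear y u.
Proof.
apply/ffunP => I; rewrite !ffunE scaler_sumr; apply: eq_bigr => S _.
by rewrite ffunE mulrCA.
Qed.

Lemma sum_decomposable u :
  u = \sum_(J : MI) u J *: decomposable (fun i j => (j == J i)%:R).
Proof.
apply/ffunP => I; rewrite sum_ffunE (bigD1 I) //= big1 ?addr0.
  by rewrite !ffunE big1 ?[_ *: _]mulr1 // => i _; rewrite eqxx.
move=> J JI; rewrite !ffunE.
suff [i Ji] : exists i, I i != J i.
  by rewrite (bigD1 i) //= (negPf Ji) mul0r scaler0.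
apply/existsP; rewrite -negb_forall; apply: contra JI => /forallP IJ.
by apply/eqP/ffunP => i; apply/esym/eqP.
Qed.

(** By linearity decomposable tensors suffice; there each shear fixes [a i ord0], so the multiples
    of it that the two shears add cancel. *)
Lemma shearK y (x : family) u : (forall i j, x i j = - y i j) ->
  shear y (shear x u) = u.
Proof.
move=> xy; rewrite [u]sum_decomposable !shear_sum; apply: eq_bigr => J _.
rewrite !shearZ !shear_decomposable; congr (_ *: _).
apply/ffunP => I; rewrite !ffunE; apply: eq_bigr => i _.
rewrite /offzero eqxx; case: ifP => _; rewrite ?mul0r ?add0r ?xy //.
by rewrite mulNr addrA subrr add0r.
Qed.

(** A shear acts linearly on every tensor factor, so it transforms [a] and [b] alike. *)
Lemma shear_tangent y a b : shear y (tangent_vector a b) =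
  tangent_vector (fun i j => offzero y j * a i ord0 + a i j)
                 (fun i j => offzero y j * b i ord0 + b i j).
Proof.
rewrite /tangent_vector shear_sum; apply: eq_bigr => i _.
rewrite shear_decomposable; apply/ffunP => I; rewrite !ffunE.
apply: eq_bigr => l _.
have [<-|il] := eqVneq i l; first by rewrite !dfwith_in.
by rewrite !dfwith_out.
Qed.

Definition weight I := #|[pred i | I i != ord0]|.

Lemma shear0 y u : shear y u (multi_index0 k) = u (multi_index0 k).
Proof.
rewrite ffunE (bigD1 finset.set0) //= big_set0 mul1r big1 ?addr0.
  by congr (u _); apply/ffunP => i; rewrite ffunE inE.
move=> S /finset.set0Pn[i iS]; rewrite (bigD1 i) //= /offzero ffunE eqxx.
by rewrite !mul0r.
Qed.

(** Only [S] empty and [S = [set i]] contribute. When the coordinate at (0,...,0) is 1, a shear thus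
    shifts the coordinates with one nonzero index by [y], so it can cancel them. *)
Lemma shear1 y u i (j : 'I_(k i).+1) : j != ord0 ->
  shear y u (upd (multi_index0 k) j) =
  u (upd (multi_index0 k) j) + y i j * u (multi_index0 k) :> C.
Proof.
move=> j0; rewrite ffunE (bigD1 finset.set0) //= big_set0 mul1r; congr (_ + _).
  by congr (u _); apply/ffunP => l; rewrite ffunE inE.
rewrite (bigD1 [set i]) /=; last by apply/finset.set0Pn; exists i; rewrite inE.
rewrite big_set1 upd_in {1}/offzero (negPf j0) big1 ?addr0.
  congr (_ * u _); apply/ffunP => l; rewrite [LHS]ffunE inE [RHS]ffunE.
  by rewrite eq_sym; have [//|il] := eqVneq i l; rewrite upd_out ?ffunE.
move=> S /andP[/finset.set0Pn[l lS] Si].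
suff [m mS mi] : exists2 m, m \in S & i != m.
  by rewrite (bigD1 m) //= upd_out // /offzero ffunE eqxx !mul0r.
have [il|] := eqVneq i l; last by exists l.
rewrite -{l}il in lS; apply/exists_inP; rewrite -negb_forall_in.
apply: contra Si => /forall_inP H; apply/eqP/finset.setP => m; rewrite inE.
by apply/idP/idP => [/H|/eqP->//]; rewrite eq_sym.
Qed.

End Tensors.

(** * Normal form of centred tangent vectors *)

Section NormalForm.
Variables (C : fieldType) (n : nat) (k : 'I_n -> nat).
Local Notation MI := (multi_index k).
Local Notation E := {ffun MI -> C^o}.
Local Notation family := (forall i, 'I_(k i).+1 -> C).
Local Notation MI0 := (multi_index0 k).
Implicit Types (I J K : MI) (a b c y : family) (u z : E).

Lemma weight_notin I (S : {set 'I_n}) : (#|S| < weight I)%N ->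
  exists2 l, l \notin S & I l != ord0.
Proof.
move=> wS; have /subsetPn[l lI lS] : ~~ ([pred i | I i != ord0] \subset S).
  by apply: contraL wS => /subset_leq_card; rewrite -leqNgt.
by exists l.
Qed.

Lemma weight_eq2 I s : I s != ord0 -> weight I = 2 ->
  exists t, [/\ t != s, I t != ord0 &
    forall l, l != s -> l != t -> I l = ord0].
Proof.
move=> Is w2; have [|t] := @weight_notin I [set s]; first by rewrite cards1 w2.
rewrite inE => ts It; exists t; split=> // l ls lt; apply/eqP/negPn/negP => Il.
have : (#|[set s; t; l]| <= weight I)%N.
  by apply/subset_leq_card/fintype.subsetP => i; rewrite !inE;
    move=> /orP[/orP[]|] /eqP->.
rewrite w2 finset.setUC cardsU1 cards2 !inE negb_or ls lt.
by rewrite eq_sym ts.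
Qed.

Lemma weightE I : (weight I)%:R = \sum_i (I i != ord0)%:R :> C.
Proof. by rewrite -natr_sum /weight -sum1_card big_mkcond. Qed.

Lemma weight0 : weight MI0 = 0%N.
Proof. by apply: eq_card0 => i; rewrite !inE ffunE eqxx. Qed.

Lemma weight1 i (j : 'I_(k i).+1) : j != ord0 -> weight (upd MI0 j) = 1%N.
Proof.
move=> j0; rewrite -(card1 i); apply: eq_card => l; rewrite !inE.
have [->|il] := eqVneq l i; first by rewrite upd_in j0.
by rewrite upd_out 1?eq_sym // ffunE eqxx.
Qed.

(** The two kinds of support: [None] imposes no condition; [Some s] keeps the supports of size 2
    that contain [s], seen as the edges at [s] of a graph on the tensor factors. *)
Definition in_star (o : option 'I_n) I :=
  if o is Some s then (I s != ord0) && (weight I == 2) else true.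

Definition monomial_value o c I : C := (in_star o I)%:R * \prod_i c i (I i).

(** In probabilistic terms, total mass 1 and all means 0. *)
Definition centred z :=
  z MI0 = 1 /\ forall i (j : 'I_(k i).+1), j != ord0 -> z (upd MI0 j) = 0.

Lemma tangent_vector0 a b : tangent_vector a b MI0 =
  \sum_i b i ord0 * \prod_(l < n | l != i) a l ord0 :> C.
Proof.
rewrite tangent_vectorE; apply: eq_bigr => i _; rewrite ffunE; congr (_ * _).
by apply: eq_bigr => l _; rewrite ffunE.
Qed.

Lemma tangent_vector1 a b i (j : 'I_(k i).+1) : tangent_vector a b (upd MI0 j) =
  b i j * (\prod_(l < n | l != i) a l ord0) +
  a i j * \sum_(m < n | m != i)
    b m ord0 * \prod_(l < n | (l != m) && (l != i)) a l ord0 :> C.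
Proof.
rewrite tangent_vectorE (bigD1 i) //= upd_in; congr (_ * _ + _).
  by apply: eq_bigr => l li; rewrite upd_out 1?eq_sym // ffunE.
rewrite mulr_sumr; apply: eq_bigr => m mi.
rewrite upd_out 1?eq_sym // ffunE mulrCA; congr (_ * _).
rewrite (bigD1 i) //= 1?eq_sym // upd_in; congr (_ * _).
by apply: eq_bigr => l /andP[_ li]; rewrite upd_out 1?eq_sym // ffunE.
Qed.

(** The hypotheses turn the [i]-th summand into [w i - (I i != ord0)%:R] times the common product;
    summing over [i] leaves 1 minus the weight. *)
Lemma tangent_vector_torus a b c (w : 'I_n -> C) : \sum_i w i = 1 ->
  (forall i j, a i j = c i j * a i ord0) ->
  (forall i j, b i j * \prod_(l < n | l != i) a l ord0 =
     c i j * (w i - (j != ord0)%:R)) ->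
  forall I, tangent_vector a b I = (1 - (weight I)%:R) * \prod_i c i (I i) :> C.
Proof.
move=> w1 ac bc I; rewrite tangent_vectorE weightE -[X in X - _]w1 -sumrB mulr_suml.
apply: eq_bigr => i _; under [X in _ * X]eq_bigr do rewrite ac.
by rewrite big_split /= mulrCA bc [in RHS](bigD1 i) //=; ring.
Qed.

(** Factors other than [s] are multiples of the basis vector of index 0, and [a s] has no component
    there. In weight at least 2 a nonzero summand must differentiate the only factor besides [s]
    with a nonzero index, which forces weight 2 and [I s != ord0]. The sign in [c s] accounts for
    [1 - 2 = -1]. *)
Lemma tangent_vector_star a b c s : a s ord0 = 0 ->
  (forall i j, i != s -> j != ord0 -> a i j = 0) ->
  (forall i, c i ord0 = 1) ->
  (forall j, j != ord0 -> c s j = - a s j) ->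
  (forall i j, i != s -> j != ord0 ->
     c i j = b i j * \prod_(l < n | (l != i) && (l != s)) a l ord0) ->
  forall I, (1 < weight I)%N ->
    tangent_vector a b I = (1 - (weight I)%:R) * monomial_value (Some s) c I :> C.
Proof.
move=> as0 a0 c0 cs ci I I2; rewrite tangent_vectorE /monomial_value /=.
have vanish i l : l != i -> a l (I l) = 0 ->
    b i (I i) * \prod_(l < n | l != i) a l (I l) = 0.
  by move=> li al; rewrite (bigD1 l) //= al mul0r mulr0.
case: (eqVneq (I s) ord0) => [Is|Is] /=.
  rewrite mul0r mulr0 big1 // => i _; have [-> {i}|is_] := eqVneq i s.
    have [|l] := @weight_notin I [set s]; first by rewrite cards1.
    by rewrite inE => ls Il; apply: (vanish _ l) => //; apply: a0.
  by apply: (vanish _ s); rewrite 1?eq_sym // Is.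
case: (eqVneq (weight I) 2) => [w2|w2]; last first.
  rewrite mul0r mulr0 big1 // => i _.
  have [|l] := @weight_notin I [set s; i].
    apply: (@leq_ltn_trans 2); first by rewrite cards2; case: (s != i).
    by rewrite ltn_neqAle eq_sym w2.
  by rewrite !inE negb_or => /andP[ls li] Il; apply: (vanish _ l) => //; apply: a0.
have [t [ts It I0]] := weight_eq2 Is w2.
rewrite (bigD1 t) //= [X in _ + X]big1 ?addr0; last first.
  by move=> i it; apply: (vanish _ t); rewrite 1?eq_sym //; apply: a0.
rewrite (bigD1 s) 1?eq_sym //= [in RHS](bigD1 t) //= [in RHS](bigD1 s) 1?eq_sym //=.
have -> : \prod_(l < n | (l != t) && (l != s)) c l (I l) = 1.
  by apply: big1 => i /andP[it is_]; rewrite I0 // c0.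
have -> : \prod_(l < n | (l != t) && (l != s)) a l (I l) =
          \prod_(l < n | (l != t) && (l != s)) a l ord0.
  by apply: eq_bigr => l /andP[lt ls]; rewrite I0.
by rewrite w2 cs // ci //; ring.
Qed.

Lemma tangent_vector_monomial a b : centred (tangent_vector a b) ->
  exists o c, (forall i, c i ord0 = 1) /\ forall I, (1 < weight I)%N ->
    tangent_vector a b I = (1 - (weight I)%:R) * monomial_value o c I :> C.
Proof.
move=> [z0 z1]; have [/existsP[s /eqP as0]|] := boolP [exists i, a i ord0 == 0].
  pose c i j : C := if j == ord0 then 1 else
    if i == s then - a i j
    else b i j * \prod_(l < n | (l != i) && (l != s)) a l ord0.
  have vanish m (P : pred 'I_n) : P s -> m != s ->
      \prod_(l < n | (l != m) && P l) a l ord0 = 0.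
    move=> Ps ms; rewrite (bigD1 s) /=; first by rewrite as0 mul0r.
    by rewrite Ps eq_sym ms.
  exists (Some s), c; split=> [i|]; first by rewrite /c eqxx.
  apply: tangent_vector_star => //.
  (* As [a s ord0 = 0], only the summand [m = s] of this coordinate survives: [a i j] times a
     divisor of the coordinate at 0, which is 1. *)
  - move=> i j is_ j0; have := z1 i j j0; rewrite tangent_vector1.
    have -> : \prod_(l < n | l != i) a l ord0 = 0.
      by rewrite (bigD1 s) 1?eq_sym //= as0 mul0r.
    rewrite mulr0 add0r (bigD1 s) 1?eq_sym //= [X in _ + X]big1 ?addr0.
      move/eqP; rewrite mulf_eq0 => /orP[/eqP//|].
      move: z0; rewrite tangent_vector0 (bigD1 s) //= [X in _ + X]big1 ?addr0.
        move=> z0; rewrite mulf_eq0 => /orP[/eqP bs|P0].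
          by move/eqP: z0; rewrite bs mul0r eq_sym oner_eq0.
        move/eqP: z0; rewrite (bigD1 i) //= (eqP P0) !mulr0.
        by rewrite eq_sym oner_eq0.
      by move=> m ms; rewrite (bigD1 s) 1?eq_sym //= as0 mul0r mulr0.
    by move=> m /andP[mi ms]; rewrite vanish ?mulr0 // eq_sym.
  - by move=> j j0; rewrite /c (negPf j0) eqxx.
  - by move=> i j is_ j0; rewrite /c (negPf j0) (negPf is_).
rewrite negb_exists => /forallP a0.
(* All [a i ord0] are nonzero: [c] is [a] scaled to 1 at index 0, and [w i] is the contribution of
   the factor [i] to the coordinate at 0. *)
pose c i j := a i j / a i ord0.
pose w i := b i ord0 * \prod_(l < n | l != i) a l ord0.
have w1 : \sum_i w i = 1 by rewrite -z0 tangent_vector0.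
exists None, c; split=> [i|I I2]; first by rewrite /c divff.
rewrite /monomial_value mul1r; apply: (tangent_vector_torus w1) => i j.
  by rewrite /c divfK.
have [->|j0] := eqVneq j ord0; first by rewrite /c divff // subr0 mul1r.
(* The vanishing mean determines [b i j]; [w i - 1] is minus the sum of the other [w m]. *)
have := z1 i j j0; rewrite tangent_vector1 => /eqP; rewrite addr_eq0 => /eqP->.
rewrite [X in _ = _ * X](_ : _ = - \sum_(m < n | m != i) w m); last first.
  by rewrite -[X in _ - X]w1 (bigD1 i) //= opprD addrA subrr add0r.
rewrite /c mulrN; congr (- _); rewrite mulrAC -mulrA.
congr (_ * _); apply: (mulIf (a0 i)).
rewrite mulfVK // !mulr_suml; apply: eq_bigr => m mi.
by rewrite /w -mulrA (bigD1 i (P := fun l => l != m)) 1?eq_sym //=; ring.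
Qed.

(** Converse of the normal form. The condition on [c s] makes the factor [a s] nonzero in the star
    case. *)
Lemma monomial_tangent_vector o c : (0 < n)%N -> (forall i, c i ord0 = 1) ->
  (forall s, o = Some s -> exists2 j, j != ord0 & c s j != 0) ->
  exists a b, [/\ forall i, exists j, a i j != 0, centred (tangent_vector a b) &
    forall I, (1 < weight I)%N ->
    tangent_vector a b I = (1 - (weight I)%:R) * monomial_value o c I :> C].
Proof.
move=> n0 c0; case: o => [s|] cs.
  (* Factor [s] is [- c s] off 0 and is differentiated towards the basis vector of index 0; every
     other factor is that basis vector and is differentiated along [c]. *)
  pose a i j : C := if i == s then (if j == ord0 then 0 else - c i j)
    else (j == ord0)%:R.
  pose b i j : C := if i == s then (j == ord0)%:R
    else (if j == ord0 then 0 else c i j).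
  have as0 : a s ord0 = 0 by rewrite /a !eqxx.
  have a1 i : i != s -> a i ord0 = 1 by move=> is_; rewrite /a (negPf is_) eqxx.
  have b0 i : i != s -> b i ord0 = 0 by move=> is_; rewrite /b (negPf is_) eqxx.
  exists a, b; split.
  - move=> i; have [->|is_] := eqVneq i s; last by exists ord0; rewrite a1 ?oner_eq0.
    have [j j0 cj] := cs _ erefl; exists j.
    by rewrite /a eqxx (negPf j0) oppr_eq0.
  - split=> [|i j j0].
      rewrite tangent_vector0 (bigD1 s) //= !big1 => [|i is_|i is_].
      - by rewrite /b !eqxx mul1r addr0.
      - by rewrite b0 // mul0r.
      - by rewrite a1.
    rewrite tangent_vector1; have [is_|is_] := eqVneq i s.
      rewrite [X in _ + _ * X]big1 => [|m mi]; last by rewrite b0 ?mul0r // -is_.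
      by rewrite /b (introT eqP is_) (negPf j0) mul0r mulr0 addr0.
    rewrite (bigD1 s) 1?eq_sym //= as0 mul0r mulr0 add0r.
    by rewrite {1}/a (negPf is_) (negPf j0) mul0r.
  - apply: tangent_vector_star => //.
    + by move=> i j is_ j0; rewrite /a (negPf is_) (negPf j0).
    + by move=> j j0; rewrite /a eqxx (negPf j0) opprK.
    + move=> i j is_ j0; rewrite big1 ?mulr1 => [|l /andP[_ /a1]//].
      by rewrite /b (negPf is_) (negPf j0).
(* Without a star condition [a = c], and the total [\sum_i w i = 1] is concentrated in one factor
   [i0]. *)
pose i0 : 'I_n := Ordinal n0.
pose w i : C := (i == i0)%:R.
pose b i j := c i j * (w i - (j != ord0)%:R).
have w1 : \sum_i w i = 1.
  rewrite (bigD1 i0) //= big1 ?addr0 /w ?eqxx // => i i0i.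
  by rewrite (negPf i0i).
have T I : tangent_vector c b I = (1 - (weight I)%:R) * \prod_i c i (I i) :> C.
  apply: (tangent_vector_torus w1) => i j; first by rewrite c0 mulr1.
  by rewrite big1 ?mulr1.
exists c, b; split=> [i||I _].
- by exists ord0; rewrite c0 oner_eq0.
- split=> [|i j j0]; first by rewrite T weight0 subr0 mul1r big1 // => i _; rewrite ffunE.
  by rewrite T weight1 // subrr mul0r.
- by rewrite T /monomial_value mul1r.
Qed.

End NormalForm.

(** * Monoid morphisms on the vertices of Q *)

Section Classification.
Variables (C : fieldType) (n : nat) (k : 'I_n -> nat).
Local Notation MI := (multi_index k).
Local Notation family := (forall i, 'I_(k i).+1 -> C).
Local Notation MI0 := (multi_index0 k).
Implicit Types (I J K : MI) (c : family).

Definition same_vertex_sum (s t : seq MI) := forall i (j : 'I_(k i).+1),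
  j != ord0 -> (\sum_(I <- s) (I i == j) = \sum_(I <- t) (I i == j))%N.

(** [psi] respects all relations between sums of vertices, as the values of a morphism from the
    generated monoid to the multiplicative monoid of [C] do. *)
Definition vertex_multiplicative (psi : MI -> C) := forall s t : seq MI,
  all (fun I => 1 < weight I)%N s -> all (fun I => 1 < weight I)%N t ->
  same_vertex_sum s t -> \prod_(I <- s) psi I = \prod_(I <- t) psi I.

Lemma weight_ge I (s : seq 'I_n) :
  uniq s -> all (fun i => I i != ord0) s -> (size s <= weight I)%N.
Proof.
move=> /card_uniqP <- /allP sI; apply/subset_leq_card/fintype.subsetP => i.
exact: sI.
Qed.

Lemma weight_gt1 I : (1 < weight I)%N -> exists i, I i != ord0.
Proof.
move=> I2; have [|i _ Ii] := @weight_notin _ _ I finset.set0; last by exists i.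
by rewrite cards0 ltnW.
Qed.

Lemma weight_upd I i (j : 'I_(k i).+1) : (weight I <= (weight (upd I j)).+1)%N.
Proof.
rewrite /weight -!sum1_card big_mkcond [in leqRHS]big_mkcond.
rewrite (bigD1 i) //= [in leqRHS](bigD1 i) //=.
rewrite -[leqRHS]add1n; apply: leq_add; first by case: ifP.
apply: leq_trans (leq_addl _ _); apply: eq_leq.
apply: eq_bigr => l li.
by rewrite !inE upd_out // eq_sym.
Qed.

Variable psi : MI -> C.
Hypothesis psiM : vertex_multiplicative psi.

(** As [I] has weight at least 3, changing one index leaves a vertex of [Q]. So [c i j] can be the
    ratio of the values of [psi] after setting the index [i] of [I] to [j] and to 0. *)
Lemma monomial_value_torus I : (2 < weight I)%N -> psi I != 0 ->
  exists c, (forall i, c i ord0 = 1) /\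
    forall J, (1 < weight J)%N -> psi J = monomial_value None c J.
Proof.
move=> I3 psiI.
have updI i (j : 'I_(k i).+1) : (1 < weight (upd I j))%N.
  by rewrite -ltnS (leq_trans I3) // weight_upd.
(* Setting one index of [I] to 0, for each [i] in turn, gives vertices adding up to [n - 1] times
   [I]; hence none of these values vanishes. *)
have psi0 i : psi (upd I (ord0 : 'I_(k i).+1)) != 0.
  suff : \prod_(i < n) psi (upd I (ord0 : 'I_(k i).+1)) != 0.
    by move/prodf_neq0; apply.
  have := @psiM [seq upd I (ord0 : 'I_(k i).+1) | i <- index_enum _] (nseq n.-1 I).
  rewrite big_map /= => ->.
  - by rewrite big_nseq -Monoid.iteropE expf_neq0.
  - by apply/allP => _ /mapP[l _ ->].
  - by rewrite all_nseq ltnW ?orbT.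
  move=> l j j0; rewrite big_map big_nseq (bigD1 l) //= upd_in.
  rewrite eq_sym (negPf j0) add0n (eq_bigr (fun=> (I l == j : nat))).
    by rewrite sum_nat_const cardC1 card_ord iter_addn_0 mulnC.
  by move=> m ml; rewrite upd_out.
pose c i (j : 'I_(k i).+1) := psi (upd I j) / psi (upd I (ord0 : 'I_(k i).+1)).
exists c; split=> [i|J J2]; first by rewrite /c divff.
rewrite /monomial_value mul1r /c prodf_div; apply: (canRL (mulfK _)).
  by apply/prodf_neq0.
(* At each [l] both sides contain [J l] once and [I l] exactly [n - 1] times, apart from zeros. *)
have := @psiM (J :: [seq upd I (ord0 : 'I_(k i).+1) | i <- index_enum _])
  [seq upd I (J i) | i <- index_enum _].
rewrite big_cons !big_map; apply.
- by rewrite /= J2; apply/allP => _ /mapP[l _ ->].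
- by apply/allP => _ /mapP[l _ ->].
move=> l j j0; rewrite big_cons !big_map (bigD1 l) //= [RHS](bigD1 l) //=.
rewrite !upd_in [ord0 == j]eq_sym (negPf j0) add0n; congr (_ + _)%N.
by apply: eq_bigr => m ml; rewrite !upd_out.
Qed.

(** * Values supported in weight 2 *)

Section Star.
Hypothesis psi3 : forall I, (2 < weight I)%N -> psi I = 0.

Lemma weight_eq2_psi I : (1 < weight I)%N -> psi I != 0 -> weight I = 2%N.
Proof.
move=> I2 psiI; apply/eqP; rewrite eqn_leq I2 andbT leqNgt.
by apply: contra psiI => /psi3->.
Qed.

(** If the supports were disjoint, the two vertices would add up to a single vertex [U] of weight
    above 2, where [psi] vanishes. *)
Lemma support_meet I J : (1 < weight I)%N -> (1 < weight J)%N ->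
  psi I != 0 -> psi J != 0 -> exists i, (I i != ord0) && (J i != ord0).
Proof.
move=> I2 J2 psiI psiJ; apply/existsP; apply: contraT; rewrite negb_exists.
move=> /forallP IJ; pose U : MI := [ffun i => if I i == ord0 then J i else I i].
have [s Is] := weight_gt1 I2.
have [t [ts It _]] := weight_eq2 Is (weight_eq2_psi I2 psiI).
have [r Jr] := weight_gt1 J2.
have Ir : I r = ord0 by apply/eqP; have := IJ r; rewrite Jr andbT negbK.
have U3 : (2 < weight U)%N.
  apply: (@weight_ge _ [:: s; t; r]); last first.
    by rewrite /= !ffunE (negPf Is) (negPf It) Ir eqxx Is It Jr.
  have sr : s != r by apply: contra_neq Is => ->.
  have tr : t != r by apply: contra_neq It => ->.
  by rewrite /= !inE negb_or eq_sym ts sr tr.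
have := @psiM [:: I; J] [:: U]; rewrite !big_cons !big_nil !mulr1 (psi3 U3) => H.
case/negP: (mulf_neq0 psiI psiJ); apply/eqP.
apply: H => /=; rewrite ?I2 ?J2 ?(ltnW U3) //.
move=> i j j0; rewrite !big_cons !big_nil ffunE !addn0.
have [Ii|Ii] := eqVneq (I i) ord0; first by rewrite Ii eq_sym (negPf j0).
have := IJ i; rewrite Ii /= negbK => /eqP->.
by rewrite [ord0 == j]eq_sym (negPf j0) addn0.
Qed.

(** Edges that meet pairwise share a point or form a triangle. If [s] in [I = {s, t}] fails because
    of [J = {t, r}], then an edge [K] missing [t] is [{s, r}], and a relation excludes this
    triangle. *)
Lemma exists_center : (exists2 I, (1 < weight I)%N & psi I != 0) ->
  exists s, forall J, (1 < weight J)%N -> psi J != 0 -> J s != ord0.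
Proof.
move=> [I I2 psiI].
have wI := weight_eq2_psi I2 psiI.
have [s Is] := weight_gt1 I2.
have [t [ts It I0]] := weight_eq2 Is wI.
have [|] := pselect (exists J, [/\ (1 < weight J)%N, psi J != 0 & J s = ord0]);
  last first.
  move=> H; exists s => J J2 psiJ; apply/eqP => Js; apply: H; by exists J.
move=> [J [J2 psiJ Js]]; exists t => K K2 psiK; apply/eqP => Kt.
have wJ := weight_eq2_psi J2 psiJ; have wK := weight_eq2_psi K2 psiK.
have Jt : J t != ord0.
  have [i /andP[Ii Ji]] := support_meet I2 J2 psiI psiJ.
  have [<-//|it] := eqVneq i t; have [is_|is_] := eqVneq i s.
    by move: Ji; rewrite is_ Js eqxx.
  by rewrite I0 ?eqxx in Ii.
have [r [rt Jr J0]] := weight_eq2 Jt wJ.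
have tr : t != r by rewrite eq_sym.
have rs : r != s by apply: contraNneq Jr => ->; rewrite Js.
have Ks : K s != ord0.
  have [i /andP[Ii Ki]] := support_meet I2 K2 psiI psiK.
  have [<-//|is_] := eqVneq i s; have [it|it] := eqVneq i t.
    by move: Ki; rewrite it Kt eqxx.
  by rewrite I0 ?eqxx in Ii.
have Kr : K r != ord0.
  have [i /andP[Ji Ki]] := support_meet J2 K2 psiJ psiK.
  have [<-//|ir] := eqVneq i r; have [it|it] := eqVneq i t.
    by move: Ki; rewrite it Kt eqxx.
  by rewrite J0 ?eqxx in Ji.
have [m [ms Km K0]] := weight_eq2 Ks wK.
have mr : r = m by apply/eqP; apply: contraNT Kr => rm; rewrite K0.
rewrite -{m}mr in ms Km K0.
have U3 : (2 < weight (upd I (J r)))%N.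
  apply: (@weight_ge _ [:: s; t; r]).
    by rewrite /= !inE negb_or eq_sym ts eq_sym rs eq_sym rt.
  by rewrite /= upd_in !upd_out // Is It Jr.
have V3 : (2 < weight (upd K (J t)))%N.
  apply: (@weight_ge _ [:: s; t; r]).
    by rewrite /= !inE negb_or eq_sym ts eq_sym rs eq_sym rt.
  by rewrite /= upd_in !upd_out // Ks Jt Kr.
(* The three sides of the triangle add up to two vertices with support [{s, t, r}], where [psi]
   vanishes. *)
have := @psiM [:: I; J; K] [:: upd I (J r); upd K (J t)].
rewrite !big_cons !big_nil !mulr1 (psi3 U3) mul0r => H.
case/negP: (mulf_neq0 psiI (mulf_neq0 psiJ psiK)); apply/eqP; apply: H => /=.
- by rewrite I2 J2 K2.
- by rewrite (ltnW U3) (ltnW V3).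
have Ir : I r = ord0 by apply: I0.
move=> i j j0; rewrite !big_cons !big_nil !addn0.
have j0' : (ord0 == j) = false by rewrite eq_sym (negPf j0).
have [it|it] := eqVneq t i; first by subst i; rewrite upd_in Kt j0' upd_out // addn0.
have [ir|ir] := eqVneq r i.
  by subst i; rewrite upd_in upd_out // Ir j0'.
rewrite !upd_out // J0 ?j0' // eq_sym //.
Qed.

Lemma monomial_value_center s I :
  (forall J, (1 < weight J)%N -> psi J != 0 -> J s != ord0) ->
  (1 < weight I)%N -> psi I != 0 ->
  exists c, [/\ forall i, c i ord0 = 1, exists2 j, j != ord0 & c s j != 0 &
    forall J, (1 < weight J)%N -> psi J = monomial_value (Some s) c J].
Proof.
move=> Hs I2 psiI; have Is := Hs I I2 psiI; have wI := weight_eq2_psi I2 psiI.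
have [t [ts It I0]] := weight_eq2 Is wI.
(* With [I = {s, t}] as reference edge, [c s j] changes the index at [s], while [c i j] replaces the
   other end by [i] with index [j] and divides by [psi I]. *)
pose c i (j : 'I_(k i).+1) : C := if j == ord0 then 1 else
  if i == s then psi (upd I j) else psi (upd (upd MI0 (I s)) j) / psi I.
have st : s != t by rewrite eq_sym.
exists c; split=> [i||J J2]; first by rewrite /c eqxx.
  by exists (I s) => //; rewrite /c (negPf Is) eqxx upd_id.
rewrite /monomial_value /=.
have [Js|Js] := eqVneq (J s) ord0.
  rewrite mul0r; apply: contra_eq Js; exact: Hs.
have [wJ|wJ] := eqVneq (weight J) 2; last first.
  by rewrite mul0r psi3 // ltn_neqAle eq_sym wJ.
have [i [is_ Ji J0]] := weight_eq2 Js wJ.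
rewrite (bigD1 s) //= (bigD1 i) //= big1 => [|l /andP[ls li]]; last first.
  by rewrite J0 // /c eqxx.
rewrite /c (negPf Js) (negPf Ji) eqxx (negPf is_) mul1r mulr1 mulrA.
apply: (canRL (mulfK psiI)).
(* The edges [J] and [I] exchange their indices at [s], which keeps the sum. *)
have := @psiM [:: J; I] [:: upd I (J s); upd (upd MI0 (I s)) (J i)].
rewrite !big_cons !big_nil !mulr1; apply=> /=.
- by rewrite I2 J2.
- rewrite andbT; apply/andP; split.
    apply: (@weight_ge _ [:: s; t]); first by rewrite /= !inE eq_sym ts.
    by rewrite /= upd_in upd_out // Js It.
  apply: (@weight_ge _ [:: s; i]); first by rewrite /= !inE eq_sym is_.
  by rewrite /= upd_in upd_out // upd_in Ji Is.
move=> l j j0; rewrite !big_cons !big_nil !addn0.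
have j0' : (ord0 == j) = false by rewrite eq_sym (negPf j0).
have [ls|ls] := eqVneq s l.
  by subst l; rewrite upd_in upd_out // upd_in.
rewrite (upd_out _ _ ls); have [li|li] := eqVneq i l.
  by subst l; rewrite upd_in addnC.
by rewrite !upd_out // J0 ?ffunE ?j0' ?addn0 // eq_sym.
Qed.

End Star.

Lemma monomial_value_of_multiplicative : exists o c,
  [/\ forall i, c i ord0 = 1,
      forall s, o = Some s -> exists2 j, j != ord0 & c s j != 0 &
      forall J, (1 < weight J)%N -> psi J = monomial_value o c J].
Proof.
have [[I I3 psiI]|psi3'] := pselect (exists2 I, (2 < weight I)%N & psi I != 0).
  by have [c [c0 Hc]] := monomial_value_torus I3 psiI; exists None, c.
have psi3 I : (2 < weight I)%N -> psi I = 0.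
  by move=> I3; apply/eqP/negPn/negP => psiI; apply: psi3'; exists I.
have [[I I2 psiI]|psi2] := pselect (exists2 I, (1 < weight I)%N & psi I != 0).
  have [|s Hs] := exists_center psi3; first by exists I.
  have [c [c0 cs Hc]] := monomial_value_center psi3 Hs I2 psiI.
  by exists (Some s), c; split=> // _ [<-].
(* Here [psi] vanishes on every vertex; so does the product of a [c] that is 0 off the index 0. *)
exists None, (fun i j => (j == ord0)%:R); split=> // J J2; rewrite /monomial_value mul1r.
have [s Js] := weight_gt1 J2.
rewrite (bigD1 s) //= (negPf Js) mul0r.
by apply/eqP/negPn/negP => psiJ; apply: psi2; exists J.
Qed.

End Classification.

(** * Lattice points of [Q] *)

Section LatticePoints.
Variables (R : realType) (n : nat) (k : 'I_n -> nat).
Local Notation MI := (multi_index k).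
Implicit Types (I J K : MI).

Definition int_vertex I : {ffun basis_index k -> int} :=
  [ffun b => (I (tag b) == lift ord0 (tagged b))%:R].

Lemma sum_eq_lift (A : nmodType) m (x : 'I_m.+1) (a : 'I_m.+1 -> A) :
  \sum_(j < m) a (lift ord0 j) *+ (x == lift ord0 j) = a x *+ (x != ord0).
Proof.
case: (unliftP ord0 x) => [j ->|->]; last first.
  by rewrite eqxx big1 // => j _; rewrite (negPf (neq_lift _ _)).
rewrite (bigD1 j) //= eqxx big1 ?addr0 // => l lj.
by rewrite (inj_eq lift_inj) eq_sym (negPf lj).
Qed.

Lemma sum1_eq_lift (A : pzSemiRingType) m (x : 'I_m.+1) :
  \sum_(j < m) (x == lift ord0 j)%:R = (x != ord0)%:R :> A.
Proof. exact: (sum_eq_lift x (fun=> 1)). Qed.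

Lemma int_vertex_lattice_point I : (1 < weight I)%N ->
  lattice_points R (int_vertex I).
Proof.
move=> I2; exists 1%N, (fun=> vertex R I), (fun=> 1); split=> //.
- by rewrite big_ord1.
- by rewrite big_ord1 scale1r; apply/ffunP => b; rewrite !ffunE; case: eqP.
Qed.

(** Each block sum of [z] is an integer and a convex combination of zeros and ones, so it is 0 or 1
    and the block contains at most one 1. The total sum is an average of weights that are at least
    2. *)
Lemma lattice_point_int_vertex z : lattice_points R z ->
  exists2 I, (1 < weight I)%N & z = int_vertex I.
Proof.
move=> Qz; have z0 := lattice_points_ge0 Qz; move: Qz => [r [p [w [Sp w0 w1 E]]]].
have [K K2 pK] : exists2 K : 'I_r -> MI,
    (forall l, 1 < weight (K l))%N & forall l, p l = vertex R (K l).
  have pK l : exists K, (1 < weight K)%N /\ p l = vertex R K.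
    by have [K K2 <-] := Sp l; exists K.
  by have [K HK] := choice pK; exists K => l; have [] := HK l.
pose N i := \sum_(j < k i) z (Tagged (fun i => 'I_(k i)) j).
have NE i : (N i)%:~R = \sum_(l < r) w l * (K l i != ord0)%:R :> R.
  rewrite /N rmorph_sum /=.
  under [RHS]eq_bigr do rewrite -sum1_eq_lift mulr_sumr.
  rewrite exchange_big; apply: eq_bigr => j _ /=.
  have := congr1 (fun f : {ffun basis_index k -> R^o} => f (Tagged _ j)) E.
  rewrite ffunE sum_ffunE => ->; apply: eq_bigr => l _.
  by rewrite ffunE pK ffunE.
have N0 i : 0 <= N i by apply: sumr_ge0.
have N1 i : N i <= 1.
  rewrite -(ler_int R) NE -[leRHS]w1; apply: ler_sum => l _.
  by apply: ler_piMr; [exact: w0 | case: (_ != _)].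
pose I : MI := [ffun i => if [pick j | z (Tagged (fun i => 'I_(k i)) j) != 0] is Some j
  then lift ord0 j else ord0].
have zI i j : z (Tagged (fun i => 'I_(k i)) j) = (I i == lift ord0 j)%:R.
  rewrite ffunE; case: pickP => [m zm|z00]; last first.
    by rewrite (negPf (neq_lift _ _)); apply/eqP; rewrite -[_ == _]negbK z00.
  rewrite (inj_eq lift_inj); have := N1 i; rewrite /N (bigD1 m) //=.
  have zm1 : 1 <= z (Tagged (fun i => 'I_(k i)) m).
    by rewrite -gtz0_ge1 lt_def zm z0.
  have [<-|mj] := eqVneq m j.
    move=> H; apply/le_anti; rewrite zm1 andbT; apply: le_trans H.
    by rewrite lerDl sumr_ge0.
  rewrite (bigD1 j) 1?eq_sym //= => H; apply/le_anti; rewrite z0 andbT.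
  have S0 : 0 <= \sum_(l < k i | (l != m) && (l != j))
      z (Tagged (fun i => 'I_(k i)) l).
    exact: sumr_ge0.
  rewrite mulr0n -(lerD2l 1) addr0; apply: le_trans H; apply: lerD => //.
  by rewrite lerDl.
exists I; last by apply/ffunP => -[i j]; rewrite zI [RHS]ffunE.
have NI i : N i = (I i != ord0)%:R.
  by rewrite -sum1_eq_lift; apply: eq_bigr => j _; rewrite zI.
rewrite -(ltr_nat R) weightE.
have -> : \sum_i (I i != ord0)%:R = \sum_l w l * (weight (K l))%:R :> R.
  under [RHS]eq_bigr do rewrite weightE mulr_sumr.
  rewrite exchange_big; apply: eq_bigr => i _ /=.
  by rewrite -NE NI; case: (_ != _).
apply: (@lt_le_trans _ _ 2); first by rewrite ltr_nat.
rewrite -[leLHS]mulr1 -[X in _ * X]w1 mulr_sumr; apply: ler_sum => l _.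
by rewrite mulrC ler_wpM2l // ler_nat.
Qed.

End LatticePoints.

(** * Closed points of the semigroup algebra *)

Section Characters.
Import monalg.
Variables (R : realType) (n : nat) (k : 'I_n -> nat).
Local Notation C := R[i].
Local Notation MI := (multi_index k).
Local Notation M := (Q_monoid R k).
Local Notation point := {lrmorphism Q_algebra R k -> C^o}.
Implicit Types (I J K : MI).

Lemma int_vertex_generated I : (1 < weight I)%N ->
  int_vertex I \in generated_submonoid (lattice_points R (k := k)).
Proof.
by move=> I2; rewrite inE => H [_]; apply; apply: int_vertex_lattice_point.
Qed.

(** Below weight 2 the default is the zero of the monoid, where every [value] is 1; [toric] relies
    on this at the index (0,...,0). *)
Definition generator I : M :=
  if pselect (1 < weight I)%N is left I2
  then exist _ (int_vertex I) (int_vertex_generated I2) else Q_monoid_zero R k.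

Lemma val_generator I : (1 < weight I)%N -> sval (generator I) = int_vertex I.
Proof. by rewrite /generator; case: pselect. Qed.

(** Lattice points of [Q] are vertices, so the vertices are the only generators to treat. *)
Lemma Q_monoid_ind (P : M -> Prop) : P (Q_monoid_zero R k) ->
  (forall x y, P x -> P y -> P (Q_monoid_add x y)) ->
  (forall I, (1 < weight I)%N -> P (generator I)) -> forall x, P x.
Proof.
move=> P0 PD PI [z Hz]; have := Hz; rewrite inE.
(* [P] lives on the subtype, so the proof of membership is carried along inside the set. *)
move=> /(_ [set z | exists Hz, P (exist _ z Hz)]%classic) [].
- split; first split.
  + by eexists; exact: P0.
  + by move=> x y [Hx Px] [Hy Py]; eexists; exact: PD Px Py.
  move=> _ /lattice_point_int_vertex[I I2 ->]; exists (int_vertex_generated I2).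
  have := PI I I2; congr P; apply: val_inj; exact: val_generator.
- by move=> Hz' Pz; rewrite (_ : Hz = Hz') //; apply: bool_irrelevance.
Qed.

Definition character (x : M) : Q_algebra R k := << x >>.

Lemma character0 : character (Q_monoid_zero R k) = 1.
Proof. by []. Qed.

Lemma characterD x y : character (Q_monoid_add x y) = character x * character y.
Proof. by rewrite /character malgM_def fgmulUU mulr1. Qed.

Lemma malgU_scale (K : monomType) (A : ringType) (c : A) (x : K) :
  << c *g x >> = c *: << x >> :> {malg A[K]}.
Proof. by apply/malgP => y; rewrite mcoeffZ !mcoeffU mulrnAr mulr1. Qed.

Lemma Q_algebra_sum (a : Q_algebra R k) : exists (s : seq M) (c : M -> C),
  a = \sum_(x <- s) c x *: character x.
Proof.
exists (finmap.enum_fset (msupp (a : {malg C[M]}))),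
  (fun x => mcoeff x (a : {malg C[M]})).
rewrite {1}[a](monalgE (a : {malg C[M]})); apply: eq_bigr => x _.
exact: malgU_scale.
Qed.

Lemma Spec_point_sum (phi : point) (s : seq M) (c : M -> C) :
  phi (\sum_(x <- s) c x *: character x) =
  \sum_(x <- s) c x * (phi (character x) : C) :> C.
Proof.
have scale a x : phi (a *: character x) = a *: phi (character x).
  exact: linearZ_LR.
by rewrite raddf_sum; apply: eq_bigr => x _ /=; rewrite scale.
Qed.

Lemma Spec_pointZ (phi : point) (c : C) x :
  phi (c *: character x) = c * (phi (character x) : C).
Proof. by have := Spec_point_sum phi [:: x] (fun=> c); rewrite !big_seq1. Qed.

Lemma Spec_point_eq (phi psi : point) :
  (forall x, phi (character x) = psi (character x)) -> phi = psi.
Proof.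
move=> E; have {}E : phi =1 psi :> (Q_algebra R k -> C).
  move=> a; have [s [c ->]] := Q_algebra_sum a.
  by rewrite !Spec_point_sum; apply: eq_bigr => x _; rewrite E.
case: phi psi E => [f cf] [g cg] /= /funext E.
case: _ / E cg => cg; congr GRing.LRMorphism.Pack.
case: cf cg => [[a1] [a2] [a3]] [[b1] [b2] [b3]].
by rewrite (Prop_irrelevance a1 b1) (Prop_irrelevance a2 b2) (Prop_irrelevance a3 b3).
Qed.

(** Universal property of the semigroup algebra: [chi] extends linearly, by [mmap], to an algebra
    morphism. *)
Lemma exists_Spec_point (chi : M -> C) : chi (Q_monoid_zero R k) = 1 ->
  (forall x y, chi (Q_monoid_add x y) = chi x * chi y) ->
  exists phi : point, forall x, phi (character x) = chi x.
Proof.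
move=> chi0 chiD.
have chi_mmorphism : mmorphism chi by split; [exact: chiD | exact: chi0].
pose h : {mmorphism M -> C} := HB.pack chi (isMultiplicative.Build _ _ _ chi_mmorphism).
pose f : Q_algebra R k -> C^o := mmap idfun h.
have fD : additive f by exact: mmap_is_additive.
have fM : multiplicative f by exact: mmap_is_multiplicative.
have fZ : scalable f by exact: mmap_is_linear.
exists (HB.pack_for point f
  (GRing.isZmodMorphism.Build (Q_algebra R k) C^o f fD)
  (GRing.isMonoidMorphism.Build (Q_algebra R k) C^o f (fM.2, fM.1))
  (GRing.isScalable.Build C (Q_algebra R k) C^o *:%R f fZ)) => x /=.
by rewrite /f /character mmapU mul1r.
Qed.

Definition value (phi : point) (x : M) : C := phi (character x).

Lemma value0 phi : value phi (Q_monoid_zero R k) = 1.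
Proof. by rewrite /value character0 rmorph1. Qed.

Lemma coordinate_Spec_cst c : @coordinate C (Spec (Q_algebra R k)) (fun=> c).
Proof.
exists (c *: character (Q_monoid_zero R k)); apply/funext => phi.
by rewrite Spec_pointZ -/(value phi _) value0 mulr1.
Qed.

Lemma coordinate_SpecM (f g : affine_point (Spec (Q_algebra R k)) -> C) :
  coordinate f -> coordinate g ->
  @coordinate C (Spec (Q_algebra R k)) (fun x => f x * g x).
Proof.
move=> [a ->] [b ->]; exists (a * b); apply/funext => phi.
exact: esym (rmorphM _ _ _).
Qed.

Lemma coordinate_value c x :
  @coordinate C (Spec (Q_algebra R k)) (fun phi => c * value phi x).
Proof.
by exists (c *: character x); apply/funext => phi; rewrite Spec_pointZ.
Qed.

Lemma valueD phi x y :
  value phi (Q_monoid_add x y) = value phi x * value phi y.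
Proof. by rewrite /value characterD; exact: rmorphM. Qed.

Lemma value_inj (phi psi : point) :
  (forall I, (1 < weight I)%N ->
     value phi (generator I) = value psi (generator I)) -> phi = psi.
Proof.
move=> E; apply: Spec_point_eq; suff H x : value phi x = value psi x by exact: H.
elim/Q_monoid_ind: x => [|x y Ex Ey|I I2].
- by rewrite !value0.
- by rewrite !valueD Ex Ey.
- exact: E.
Qed.

Lemma value_multiplicative (phi : point) :
  vertex_multiplicative (fun I => value phi (generator I)).
Proof.
pose total (s : seq MI) : M :=
  foldr (fun I => Q_monoid_add (generator I)) (Q_monoid_zero R k) s.
have totalE s : \prod_(I <- s) value phi (generator I) = value phi (total s).
  elim: s => [|I s IH]; first by rewrite big_nil value0.
  by rewrite big_cons IH valueD.
have val_total s : all (fun I => 1 < weight I)%N s ->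
    sval (total s) = \sum_(I <- s) int_vertex I.
  elim: s => [|I s IH] /=; first by rewrite big_nil.
  by case/andP=> I2 /IH sE; rewrite big_cons -sE val_generator.
move=> s t s2 t2 st; rewrite !totalE; congr (value phi _).
apply: val_inj; rewrite /= !val_total //; apply/ffunP => b.
rewrite !sum_ffunE.
have vE (r : seq MI) : \sum_(I <- r) int_vertex I b =
    (\sum_(I <- r) (I (tag b) == lift ord0 (tagged b)))%N%:R.
  by rewrite natr_sum; apply: eq_bigr => I _; rewrite ffunE.
by rewrite !vE st.
Qed.

Definition block_degree (P : pred 'I_n) (z : {ffun basis_index k -> int}) : int :=
  \sum_(b : basis_index k | P (tag b)) z b.

Lemma block_degreeD P x y :
  block_degree P (x + y) = block_degree P x + block_degree P y.
Proof. by rewrite -big_split; apply: eq_bigr => b _; rewrite ffunE. Qed.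

Lemma block_degree_vertex P I :
  block_degree P (int_vertex I) = \sum_(i | P i) (I i != ord0)%:R.
Proof.
rewrite /block_degree; under [RHS]eq_bigr do rewrite -sum1_eq_lift.
by rewrite sig_big_dep; apply: eq_big => b; rewrite ?andbT // ffunE.
Qed.

(** A supporting inequality of the cone over [Q]: a vertex has degree at most 1 at [s] and a nonzero
    index elsewhere. *)
Lemma block_degree_le s (x : M) :
  block_degree (pred1 s) (sval x) <= block_degree (predC1 s) (sval x).
Proof.
elim/Q_monoid_ind: x => [|x y Hx Hy|I I2].
- by rewrite /block_degree !big1 // => b _; rewrite ffunE.
- by rewrite !block_degreeD lerD.
rewrite val_generator // !block_degree_vertex big_pred1_eq.
have [|t] := @weight_notin _ _ I [set s]; first by rewrite cards1.
rewrite inE => ts It; rewrite (bigD1 t) //= It; apply: (@le_trans _ _ 1).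
  by case: (_ != _).
by rewrite lerDl sumr_ge0.
Qed.

(* The face of the cone over Q spanned by the vertices lying in the star of o. *)
Definition on_face (o : option 'I_n) (x : M) : bool :=
  if o is Some s
  then block_degree (pred1 s) (sval x) == block_degree (predC1 s) (sval x)
  else true.

(** Equality in a sum of two valid inequalities forces equality in each, so the indicator of a face
    is multiplicative. *)
Lemma on_faceD o x y : on_face o (Q_monoid_add x y) = on_face o x && on_face o y.
Proof.
case: o => //= s; rewrite !block_degreeD.
have eqD (a b c d : int) : a <= b -> c <= d ->
    (a + c == b + d) = (a == b) && (c == d) by lia.
by apply: eqD; apply: block_degree_le.
Qed.

Lemma on_face_generator o I : (1 < weight I)%N ->
  on_face o (generator I) = in_star o I.
Proof.
case: o => //= s I2; rewrite val_generator // !block_degree_vertex big_pred1_eq.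
have : (weight I)%:R = \sum_i (I i != ord0)%:R :> int.
  by rewrite -natr_sum /weight -sum1_card big_mkcond.
rewrite (bigD1 s) //=.
have starE (b : bool) (w : nat) (d : int) : (1 < w)%N -> w%:R = b%:R + d ->
    (b%:R == d) = b && (w == 2) by case: b => /=; lia.
exact: starE.
Qed.

(** The required morphism is the indicator of the face times a monomial in the nonnegative
    coordinates. *)
Lemma monomial_value_Spec_point o (c : forall i, 'I_(k i).+1 -> C) :
  (forall i, c i ord0 = 1) ->
  exists phi : point, forall I, (1 < weight I)%N ->
    value phi (generator I) = monomial_value o c I.
Proof.
move=> c0; pose chi (x : M) : C := (on_face o x)%:R *
  \prod_(b : basis_index k) c (tag b) (lift ord0 (tagged b)) ^+ `|sval x b|%N.
have [||phi phiE] := @exists_Spec_point chi.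
- rewrite /chi big1 => [|b _]; last by rewrite ffunE expr0.
  rewrite mulr1; case: (o) => // s; rewrite /on_face /block_degree /=.
  by rewrite !big1 // => b _; rewrite ffunE.
- move=> x y; rewrite /chi on_faceD mulrACA -big_split /= -natrM mulnb.
  congr (_ * _); apply: eq_bigr => b _; rewrite ffunE -exprD; congr (_ ^+ _).
  have absD (a d : int) : 0 <= a -> 0 <= d -> absz (a + d) = (absz a + absz d)%N.
    lia.
  exact: absD (Q_monoid_ge0 x b) (Q_monoid_ge0 y b).
exists phi => I I2; rewrite /value phiE /chi on_face_generator //; congr (_ * _).
pose F i (j : 'I_(k i)) := c i (lift ord0 j) ^+ (I i == lift ord0 j).
transitivity (\prod_(b : basis_index k) F (tag b) (tagged b)).
  by apply: eq_bigr => b _; rewrite val_generator // ffunE /F; case: (_ == _).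
rewrite -(sig_big_dep (fun=> true) (fun _ _ => true) F) /= /F.
apply: eq_bigr => i _; case: (unliftP ord0 (I i)) => [j ->|->].
  rewrite (bigD1 j) //= eqxx big1 ?mulr1 // => l lj.
  by rewrite (inj_eq lift_inj) eq_sym (negPf lj).
by rewrite c0 big1 // => l _; rewrite (negPf (neq_lift _ _)).
Qed.

End Characters.

(** * Tangent lines to the Segre variety *)

Lemma dhomog_meval (C : fieldType) m d (F : {mpoly C[m]}) (c : C) (v : 'I_m -> C) :
  F \is d.-homog -> F.@[fun j => c * v j] = c ^+ d * F.@[v].
Proof.
move=> /dhomogP Fd; rewrite !mevalE mulr_sumr; apply: eq_big_seq => mon /Fd <-.
under eq_bigr do rewrite exprMn.
by rewrite big_split /= prodrXr -mdegE mulrCA.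
Qed.

Lemma dhomog_mderiv (C : fieldType) m d (F : {mpoly C[m]}) j :
  F \is d.-homog -> F^`M(j) \is d.-1.-homog.
Proof.
move=> Fd; apply/dhomogP => mon; rewrite mcoeff_msupp mcoeff_deriv => Fm.
have : (mon + U_(j))%MM \in msupp F.
  by rewrite mcoeff_msupp; apply: contraNneq Fm => ->; rewrite mul0rn.
by move/dhomogP: Fd => /[apply] /=; rewrite mdegD mdeg1 addn1 => <-.
Qed.

Lemma mderivXU (C : fieldType) m (i j : 'I_m) :
  'X_i^`M(j) = (i == j)%:R :> {mpoly C[m]}.
Proof.
rewrite mderivX mnm1E; case: eqVneq => [->|_]; last by rewrite scale0r.
by rewrite -{1}[U_(j)%MM]add0m addmK mpolyX0 scale1r.
Qed.

(** * Polynomials along curves *)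

Section Curves.
Variables (C : numFieldType) (m : nat).
Implicit Types (F G : {mpoly C[m]}) (P : 'I_m -> {poly C}).

Lemma horner_mmap F P t : (mmap (@polyC C) P F).[t] = F.@[fun j => (P j).[t]].
Proof.
elim/mpolyind: F => [|c mon p _ _ IH]; first by rewrite rmorph0 horner0 meval0.
rewrite mmapD hornerD IH mevalD mmapZ hornerCM mevalZ mmapX mevalX /mmap1.
by rewrite horner_prod; under eq_bigr do rewrite horner_exp.
Qed.

(** Chain rule along the polynomial curve [P]; the Leibniz rule [DM] reduces it to single
    variables. *)
Lemma deriv_mmap F P : (mmap (@polyC C) P F)^`() =
  \sum_j (P j)^`() * mmap (@polyC C) P F^`M(j).
Proof.
pose D G := \sum_j (P j)^`() * mmap (@polyC C) P G^`M(j).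
have DM G H : (mmap (@polyC C) P G)^`() = D G -> (mmap (@polyC C) P H)^`() = D H ->
    (mmap (@polyC C) P (G * H))^`() = D (G * H).
  move=> DG DH; rewrite rmorphM derivM DG DH /D mulr_suml mulr_sumr -big_split.
  by apply: eq_bigr => j _ /=; rewrite mderivM rmorphD !rmorphM /=; ring.
have D1 : (mmap (@polyC C) P 1)^`() = D 1.
  by rewrite rmorph1 derivC /D big1 // => j _; rewrite mderivC rmorph0 mulr0.
have DX mon : (mmap (@polyC C) P 'X_[mon])^`() = D 'X_[mon].
  rewrite mpolyXE_id; elim/big_ind: _ => // i _.
  elim: (mon i) => [|q IH]; rewrite ?expr0 // exprS; apply: DM => //.
  rewrite mmapX mmap1U /D (bigD1 i) //= big1 ?addr0 => [|j ji].
    by rewrite mderivXU eqxx rmorph1 mulr1.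
  by rewrite mderivXU eq_sym (negPf ji) rmorph0 mulr0.
elim/mpolyind: F => [|c mon p _ _ IH].
  by rewrite rmorph0 deriv0 big1 // => j _; rewrite mderiv0 rmorph0 mulr0.
rewrite mmapD mmapZ derivD IH derivM derivC mul0r add0r DX /D mulr_sumr -big_split.
apply: eq_bigr => j _ /=.
by rewrite mderivD mderivZ mmapD mmapZ mulrDr mulrCA.
Qed.

Lemma deriv_prod (T : finType) (p : T -> {poly C}) :
  (\prod_i p i)^`() = \sum_i (p i)^`() * \prod_(j | j != i) p j.
Proof.
elim: (index_enum T) (index_enum_uniq T) => [|x r IH] /=.
  by rewrite !big_nil derivC.
case/andP=> xr /IH {}IH; rewrite !big_cons derivM IH eqxx /=; congr (_ * _ + _).
  rewrite big_seq [RHS]big_seq_cond; apply: eq_bigl => j.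
  by case: eqP => [->|_]; rewrite ?andbT ?(negPf xr).
rewrite mulr_sumr [LHS]big_seq [RHS]big_seq; apply: eq_bigr => i ir.
rewrite big_cons; case: eqP => [xi|_]; last by rewrite mulrCA.
by rewrite -xi (negPf xr) in ir.
Qed.

(** In characteristic 0 the first natural numbers would give a nonzero [p] as many as [size p]
    distinct roots. *)
Lemma poly_eq0_horner (p : {poly C}) : (forall t, p.[t] = 0) -> p = 0.
Proof.
move=> p0; apply/eqP; apply: contraT => pn0.
have := @max_poly_roots _ p [seq i%:R | i <- iota 0 (size p)] pn0.
rewrite size_map size_iota ltnn => H; apply: H.
  by apply/allP => x _; rewrite /root p0.
by rewrite map_inj_uniq ?iota_uniq // => i j /eqP; rewrite eqr_nat => /eqP.
Qed.

End Curves.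

(** * Directional derivatives of polynomials *)

Section DirectionalDerivative.
Variables (C : fieldType) (T : finType).
Local Notation E := {ffun T -> C^o}.
Implicit Types (F G : {mpoly C[#|T|]}) (v w : E).

Definition coord_var (t : T) : {mpoly C[#|T|]} := 'X_(enum_rank t).

Lemma peval_coord_var t v : peval (coord_var t) v = v t.
Proof. by rewrite /peval mevalXU enum_rankK. Qed.

Lemma coord_var_homog t : coord_var t \is 1.-homog.
Proof. by rewrite dhomogX /= mdeg1. Qed.

Lemma peval_homog d F (c : C) v : F \is d.-homog ->
  peval F (c *: v) = c ^+ d * peval F v.
Proof.
move=> Fd; rewrite /peval -(dhomog_meval _ _ Fd).
by apply: meval_eq => j; rewrite ffunE.
Qed.

Lemma directional_derivativeD F v w1 w2 : directional_derivative F v (w1 + w2) =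
  directional_derivative F v w1 + directional_derivative F v w2.
Proof. by rewrite -big_split; apply: eq_bigr => j _; rewrite ffunE mulrDl. Qed.

Lemma directional_derivativeZ F v (c : C) w :
  directional_derivative F v (c *: w) = c * directional_derivative F v w.
Proof. by rewrite mulr_sumr; apply: eq_bigr => j _; rewrite ffunE mulrA. Qed.

Lemma directional_derivative_homog d F (c : C) v w : F \is d.-homog ->
  directional_derivative F (c *: v) w = c ^+ d.-1 * directional_derivative F v w.
Proof.
move=> Fd; rewrite mulr_sumr; apply: eq_bigr => j _.
by rewrite (peval_homog _ _ (dhomog_mderiv j Fd)) mulrCA.
Qed.

Lemma directional_derivativeB F G v w : directional_derivative (F - G) v w =
  directional_derivative F v w - directional_derivative G v w.
Proof.
rewrite -sumrB; apply: eq_bigr => j _.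
by rewrite mderivB /peval mevalB mulrBr.
Qed.

Lemma directional_derivative_mulX s t v w :
  directional_derivative (coord_var s * coord_var t) v w = w s * v t + v s * w t.
Proof.
have sumX r : \sum_(j < #|T|) w (enum_val j) * peval (coord_var r)^`M(j) v = w r.
  rewrite (bigD1 (enum_rank r)) //= big1 ?addr0 => [|j jr].
    by rewrite /coord_var mderivXU eqxx /peval meval1 mulr1 enum_rankK.
  by rewrite /coord_var mderivXU eq_sym (negPf jr) /peval meval0 mulr0.
rewrite -(sumX s) -(sumX t) mulr_suml mulr_sumr -big_split.
apply: eq_bigr => j _ /=; rewrite mderivM /peval mevalD !mevalM.
by rewrite -!/(peval _ _) !peval_coord_var; ring.
Qed.

End DirectionalDerivative.

(** * Tangent vectors lie in the embedded tangent space *)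

Section TangentSpace.
Variables (C : numFieldType) (n : nat) (k : 'I_n -> nat).
Variables (V : 'I_n -> vectType C) (e : forall i, (k i).+1.-tuple (V i)).
Hypothesis e_basis : forall i, basis_of {: V i} (e i).
Local Notation MI := (multi_index k).
Local Notation E := {ffun MI -> C^o}.
Local Notation family := (forall i, 'I_(k i).+1 -> C).
Implicit Types (I J K : MI) (a b : family) (u : E).

Definition nonzero_family a := forall i, exists j, a i j != 0.

Lemma decomposable_neq0 a : nonzero_family a -> decomposable a != 0.
Proof.
move=> a0; have H i : {j | a i j != 0} by apply: cid.
apply/eqP => /(congr1 (fun u : E => u [ffun i => sval (H i)])).
rewrite !ffunE => /eqP; apply/negP/prodf_neq0 => i _; rewrite ffunE.
exact: svalP (H i).
Qed.

Lemma nonzero_family_decomposable a : decomposable a != 0 -> nonzero_family a.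
Proof.
move=> da i; apply: contrapT => ai; case/eqP: da.
apply/ffunP => I; rewrite !ffunE (bigD1 i) //=.
suff -> : a i (I i) = 0 by rewrite mul0r.
by apply: contrapT => /eqP H; apply: ai; exists (I i).
Qed.

Lemma segreP p : segre e p <->
  exists2 a, nonzero_family a & p = <[decomposable a]>%VS.
Proof.
split=> [[v v0 ->]|[a a0 ->]].
  exists (fun i j => coord (e i) j (v i)) => [i|].
    apply: contrapT => H; case/eqP: (v0 i).
    rewrite (coord_basis (e_basis i) (memvf (v i))) big1 // => j _.
    rewrite (_ : coord _ _ _ = 0) ?scale0r //; apply: contrapT => /eqP cj.
    by apply: H; exists j.
  by congr (<[_]>%VS); apply/ffunP => I; rewrite !ffunE.
pose v i : V i := \sum_j a i j *: (e i)`_j.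
have va i j : coord (e i) j (v i) = a i j.
  by rewrite coord_sum_free // (basis_free (e_basis i)).
exists v => [i|]; last first.
  congr (<[_]>%VS); apply/ffunP => I; rewrite !ffunE.
  by apply: eq_bigr => i _; rewrite va.
have [j aj] := a0 i; apply: contra_neq aj => vi.
by rewrite -va vi linear0.
Qed.

(** Vanishing extends to families with a zero factor, through which the curves used below may pass:
    the zero tensor is 0 times a tensor of the Segre cone. *)
Lemma peval_decomposable d (F : {mpoly C[#|{: MI}|]}) a : F \is d.-homog ->
  vanishes_on (segre e) F -> (exists a0, nonzero_family a0) ->
  peval F (decomposable a) = 0.
Proof.
move=> Fd F0 [a0 Ha0].
have Fnz b : nonzero_family b -> peval F (decomposable b) = 0.
  by move=> Hb; apply: F0; [exact: decomposable_neq0 | apply/segreP; exists b].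
have [da|] := eqVneq (decomposable a) 0; last first.
  by move=> /nonzero_family_decomposable; exact: Fnz.
by rewrite da -(scale0r (decomposable a0)) (peval_homog _ _ Fd) Fnz ?mulr0.
Qed.

Lemma tangent_vectorZ a b (c : C) :
  tangent_vector a (fun i j => c * b i j) = c *: tangent_vector a b.
Proof.
apply/ffunP => I; rewrite ffunE !tangent_vectorE scaler_sumr.
by apply: eq_bigr => i _; rewrite -mulrA.
Qed.

Lemma tangent_vectorD a b b' : tangent_vector a (fun i j => b i j + b' i j) =
  tangent_vector a b + tangent_vector a b'.
Proof.
apply/ffunP => I; rewrite ffunE !tangent_vectorE -big_split.
by apply: eq_bigr => i _; rewrite mulrDl.
Qed.

Lemma tangent_vector_self a i0 :
  tangent_vector a (fun i j => (i == i0)%:R * a i j) = decomposable a.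
Proof.
apply/ffunP => I; rewrite tangent_vectorE ffunE [RHS](bigD1 i0) //=.
rewrite (bigD1 i0) //= eqxx mul1r [X in _ + X]big1 ?addr0 // => i ii0.
by rewrite (negPf ii0) !mul0r.
Qed.

(** [F] vanishes along the curve of decomposable tensors with factors [a i + t b i]; its derivative
    at [t = 0] is the directional derivative. *)
Lemma directional_derivative_tangent_vector d (F : {mpoly C[#|{: MI}|]}) a b (c : C) :
  nonzero_family a -> F \is d.-homog -> vanishes_on (segre e) F ->
  directional_derivative F (c *: decomposable a) (tangent_vector a b) = 0.
Proof.
move=> a0 Fd F0; rewrite (directional_derivative_homog _ _ _ Fd).
suff -> : directional_derivative F (decomposable a) (tangent_vector a b) = 0.
  by rewrite mulr0.
pose P (j : 'I_#|{: MI}|) : {poly C} :=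
  \prod_i ((a i (enum_val j i))%:P + (b i (enum_val j i))%:P * 'X).
have PE j t : (P j).[t] =
    decomposable (fun i l => a i l + b i l * t) (enum_val j).
  rewrite horner_prod ffunE; apply: eq_bigr => i _.
  by rewrite hornerD hornerMX !hornerC.
have P0 : mmap (@polyC C) P F = 0.
  apply: poly_eq0_horner => t; rewrite horner_mmap.
  rewrite -(peval_decomposable (fun i l => a i l + b i l * t) Fd F0); last by exists a.
  exact: meval_eq.
have := congr1 (fun p : {poly C} => p^`().[0]) P0.
rewrite deriv_mmap deriv0 horner0 horner_sum => <-; apply: eq_bigr => j _.
rewrite hornerM horner_mmap; congr (_ * _).
  rewrite tangent_vectorE /P.
  rewrite deriv_prod horner_sum; apply: eq_bigr => i _.
  rewrite hornerM horner_prod derivD derivC add0r derivM derivC mul0r add0r derivX.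
  rewrite mulr1 hornerC; congr (_ * _); apply: eq_bigr => l _.
  by rewrite hornerD hornerMX !hornerC mulr0 addr0.
apply: meval_eq => l; rewrite PE !ffunE.
by apply: eq_bigr => i _; rewrite mulr0 addr0.
Qed.

End TangentSpace.

(** * Points of the tangential variety *)

Section TangentialVariety.
Variables (C : numFieldType) (n : nat) (k : 'I_n -> nat).
Variables (V : 'I_n -> vectType C) (e : forall i, (k i).+1.-tuple (V i)).
Hypothesis e_basis : forall i, basis_of {: V i} (e i).
Local Notation MI := (multi_index k).
Local Notation E := {ffun MI -> C^o}.
Local Notation family := (forall i, 'I_(k i).+1 -> C).
Implicit Types (I J K : MI) (a b : family) (u : E).

Lemma vlineN0 (c : C) u : c != 0 -> <[c *: u]>%VS = <[u]>%VS.
Proof.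
move=> c0; apply/eqP; rewrite eqEsubv -!memvE; apply/andP; split.
  by rewrite memvZ ?memv_line.
by rewrite -{1}[u](scalerK c0) memvZ // memv_line.
Qed.

(** A tangent line has dimension 2 as a subspace, so a tangent vector proportional to [v] has to be
    completed by another one. *)
Lemma tangent_vector_tangential a b : (0 < n)%N -> (forall i, (1 <= k i)%N) ->
  nonzero_family a -> tangent_vector a b != 0 ->
  tangential_variety (segre e) <[tangent_vector a b]>%VS.
Proof.
move=> n0 k1 a0 u0; split; first by rewrite dim_vline u0.
pose i0 : 'I_n := Ordinal n0; pose v := decomposable a.
have v0 : v != 0 by exact: decomposable_neq0.
have [b' b'v uL] : exists2 b', tangent_vector a b' \notin <[v]>%VS &
    tangent_vector a b \in <<[:: tangent_vector a b'; v]>>%VS.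
  have [uv|uv] := boolP (tangent_vector a b \in <[v]>%VS); last first.
    by exists b => //; apply: memv_span; rewrite mem_head.
  have H i : {j | a i j != 0} by apply: cid.
  pose K : MI := [ffun i => sval (H i)].
  have aK i : a i (K i) != 0 by rewrite ffunE; exact: svalP (H i).
  have [j jK] : exists j, j != K i0.
    have [K0|K0] := eqVneq (K i0) ord0; last by exists ord0; rewrite eq_sym.
    by exists (lift ord0 (Ordinal (k1 i0))); rewrite K0 eq_sym neq_lift.
  (* A direction in the factor [i0] alone, along an index [j] other than [K i0]: its tangent vector
     vanishes at [K], where [v] does not, and is nonzero at [upd K j]. *)
  pose b' i (l : 'I_(k i).+1) : C :=
    ((i == i0) && (upd K j i == l))%:R.
  have b'K I : tangent_vector a b' I =
      (upd K j i0 == I i0)%:R * \prod_(l < n | l != i0) a l (I l).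
    rewrite tangent_vectorE (bigD1 i0) //= [X in _ + X]big1 ?addr0.
      by rewrite /b' eqxx.
    by move=> i ii0; rewrite /b' (negPf ii0) mul0r.
  exists b'; last first.
    rewrite span_cons span_seq1; apply: subvP uv; exact: addvSr.
  apply/negP => /vlineP[c cE].
  have := congr1 (fun u : E => u K) cE; rewrite b'K upd_in (negPf jK) mul0r ffunE.
  move/esym/eqP; rewrite mulf_eq0 => /orP[/eqP c0|]; last first.
    by rewrite ffunE; apply/negP/prodf_neq0 => i _.
  have := congr1 (fun u : E => u (upd K j)) cE; rewrite c0 scale0r ffunE.
  rewrite b'K eqxx mul1r => /eqP; apply/negP/prodf_neq0 => i ii0.
  by rewrite upd_out // eq_sym.
exists <[v]>%VS, <<[:: tangent_vector a b'; v]>>%VS; split; last first.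
  by rewrite -memvE.
split.
- by rewrite dim_vline v0; split=> //; apply/(segreP e_basis); exists a.
- have : free [:: tangent_vector a b'; v].
    by rewrite free_cons span_seq1 b'v seq1_free.
  by rewrite /free /= => /eqP.
- by rewrite span_cons span_seq1 addvSr.
move=> d F Fd F0 _ w /vlineP[c ->].
rewrite span_cons span_seq1 => /memv_addP[_ /vlineP[x ->]] [_ /vlineP[y ->] ->].
rewrite directional_derivativeD !directional_derivativeZ.
rewrite /v -{3}(tangent_vector_self a i0).
by rewrite !(directional_derivative_tangent_vector e_basis _ _ a0 Fd F0) !mulr0 addr0.
Qed.

(** The 2 x 2 minors of the flattening that separates the factor [i] from the others. *)
Definition minor I J i : {mpoly C[#|{: MI}|]} :=
  coord_var C I * coord_var C J - coord_var C (upd I (J i)) * coord_var C (upd J (I i)).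

Lemma minor_vanishes I J i : vanishes_on (segre e) (minor I J i).
Proof.
move=> v v0 /(segreP e_basis)[a a0 E].
have /vlineP[c ->] : v \in <[decomposable a]>%VS by rewrite -E memv_line.
have cE L : (c *: decomposable a) L = c * decomposable a L :> C by rewrite ffunE.
rewrite /peval mevalB !mevalM -!/(peval _ _) !peval_coord_var !cE.
rewrite [X in X - _]mulrACA [X in _ - X]mulrACA -mulrBr.
rewrite (_ : _ - _ = 0) ?mulr0 //; apply/eqP.
rewrite subr_eq0 !ffunE; apply/eqP.
rewrite (bigD1 i) // [X in _ * X](bigD1 i) //=.
rewrite [in RHS](bigD1 i) // [X in _ = _ * X](bigD1 i) //= !upd_in.
rewrite mulrACA [RHS]mulrACA [a i (J i) * _]mulrC; congr (_ * (_ * _)).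
  by apply: eq_bigr => l li; rewrite upd_out // eq_sym.
by apply: eq_bigr => l li; rewrite upd_out // eq_sym.
Qed.

Lemma minor_homog I J i : minor I J i \is 2.-homog.
Proof.
by apply: rpredB; apply: (dhomogM (d := 1) (e := 1)); exact: coord_var_homog.
Qed.

Definition minor_tangent a u := forall I J i,
  u I * decomposable a J + decomposable a I * u J =
  u (upd I (J i)) * decomposable a (upd J (I i)) +
  decomposable a (upd I (J i)) * u (upd J (I i)) :> C.

Lemma minor_tangentP a u : (forall I J i,
  directional_derivative (minor I J i) (decomposable a) u = 0) <-> minor_tangent a u.
Proof.
by split=> H I J i; move: (H I J i); rewrite directional_derivativeB
  !directional_derivative_mulX; [move/eqP; rewrite subr_eq0 => /eqP|
  move=> ->; rewrite subrr].
Qed.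

(** A tangent vector is fitted to [u] at an index [K] where all factors are nonzero and at the
    neighbours of [K]; the difference [z] then vanishes everywhere, by induction on the number of
    places where an index differs from [K]. *)
Lemma minor_tangent_vector a u : (0 < n)%N -> nonzero_family a ->
  minor_tangent a u -> exists b, u = tangent_vector a b.
Proof.
move=> n0 a0 ua; pose i0 : 'I_n := Ordinal n0.
have H i : {j | a i j != 0} by apply: cid.
pose K : MI := [ffun i => sval (H i)].
have aK i : a i (K i) != 0 by rewrite ffunE; exact: svalP (H i).
have pK : decomposable a K != 0 by rewrite ffunE; apply/prodf_neq0 => i _.
have aK' i : \prod_(l < n | l != i) a l (K l) != 0 by apply/prodf_neq0.
pose c : C := u K / decomposable a K.
(* [b] fits [u] at the neighbours of [K] after removal of the multiple [c] of [decomposable a] that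
   fits it at [K]; [b'] puts this multiple back through the factor [i0]. *)
pose b i (j : 'I_(k i).+1) : C := (u (upd K j) - c * decomposable a (upd K j)) /
  \prod_(l < n | l != i) a l (K l).
have bK i : b i (K i) = 0 by rewrite /b upd_id /c divfK // subrr mul0r.
pose b' i (j : 'I_(k i).+1) : C := b i j + c * ((i == i0)%:R * a i j).
exists b'; pose z := u - tangent_vector a b'.
have za : minor_tangent a z.
  have ta : minor_tangent a (tangent_vector a b').
    apply/minor_tangentP => I J i; rewrite -[decomposable a]scale1r.
    exact: (directional_derivative_tangent_vector e_basis _ _ a0
      (minor_homog I J i) (minor_vanishes _ _ _)).
  have zE L : z L = (u L : C) - tangent_vector a b' L by rewrite !ffunE.
  move=> I J i; rewrite !zE !mulrBl !mulrBr addrACA -opprD.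
  by rewrite [RHS]addrACA -opprD (ua I J i) (ta I J i).
have zK i (j : 'I_(k i).+1) : z (upd K j) = 0.
  rewrite ffunE tangent_vectorD tangent_vectorZ tangent_vector_self !ffunE.
  rewrite tangent_vectorE (bigD1 i) //= [X in _ + X + _]big1 ?addr0.
    rewrite upd_in (eq_bigr (fun l => a l (K l))).
      by rewrite /b divfK // ffunE subrK subrr.
    by move=> l li; rewrite upd_out // eq_sym.
  by move=> m mi; rewrite upd_out 1?eq_sym // bK mul0r.
have zK0 : z K = 0 by rewrite -(upd_id K i0) zK.
suff z0 : z = 0 by apply/eqP; rewrite -subr_eq0; apply/eqP.
apply/ffunP => I; rewrite [RHS]ffunE.
have [m] := ubnP #|[pred i | I i != K i]|; elim: m I => // m IH I ltm.
have [|] := pickP [pred i | I i != K i] => [i /= Ii|IK]; last first.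
  rewrite (_ : I = K) //; apply/ffunP => i; apply/eqP.
  by have := IK i; rewrite /= => /negbFE.
have zI : z (upd I (K i)) = 0.
  apply: IH; apply: leq_trans (_ : _ < #|[pred i | I i != K i]|)%N ltm.
  apply: proper_card; apply/properP; split.
    apply/fintype.subsetP => l; rewrite !inE; have [<-|il] := eqVneq i l.
      by rewrite upd_in eqxx.
    by rewrite upd_out.
  by exists i; rewrite !inE // upd_in eqxx.
(* Only [z I * decomposable a K] survives: [z] is 0 at [K], at its neighbours, and at [upd I (K i)],
   which is closer to [K]. *)
have := za I K i; rewrite zI zK zK0 !mulr0 mul0r !addr0 => /eqP.
by rewrite mulf_eq0 (negPf pK) orbF => /eqP.
Qed.

Lemma tangential_tangent_vector p : (0 < n)%N ->
  tangential_variety (segre e) p ->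
  exists a b, nonzero_family a /\ p = <[tangent_vector a b]>%VS.
Proof.
move=> n0 [p1 [q [L [[[q1 /(segreP e_basis)[a a0 qE]] _ _ HL] pL]]]].
have pE : p = <[vpick p]>%VS.
  apply/esym/eqP; rewrite eqEdim -memvE memv_pick p1 dim_vline.
  by rewrite vpick0 -dimv_eq0 p1.
have [|b bE] := @minor_tangent_vector a (vpick p) n0 a0; last first.
  by exists a, b; rewrite -bE.
apply/minor_tangentP => I J i; apply: (HL 2) => //.
- exact: minor_homog.
- exact: minor_vanishes.
- by rewrite qE memv_line.
- exact: (subvP pL) (memv_pick p).
Qed.

End TangentialVariety.

(** * The isomorphism *)

Section Morphisms.
Local Open Scope classical_set_scope.

(** Preimages commute with unions and regularity is local, so principal open sets and fractions
    suffice. *)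
Lemma locally_fractional_morphism (C X Y : Type)
    (prX : set (set X)) (frX : set X -> set (X -> C))
    (prY : set (set Y)) (frY : set Y -> set (Y -> C)) (f : X -> Y) :
  (forall D, prY D -> prX (f @^-1` D)) ->
  (forall N h, frY N h -> frX (f @^-1` N) (h \o f)) ->
  @is_morphism C (locally_fractional prX frX) (locally_fractional prY frY) f.
Proof.
move=> prf frf; have opf V : @zopen C (locally_fractional prY frY) V ->
    @zopen C (locally_fractional prX frX) (f @^-1` V).
  move=> [S Spr ->]; exists [set f @^-1` D | D in S].
    by move=> _ [D /Spr /prf ? <-].
  apply/seteqP; split=> x [D SD Dx]; first by exists (f @^-1` D) => //; exists D.
  by case: SD Dx => B SB <- Bx; exists B.
split=> [|V h _ /= regh]; first exact: opf.
move=> /= x Vx; have [N [opN Nx NV frN]] := regh _ Vx.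
exists (f @^-1` N); split=> //; [exact: opf | by move=> y /NV | exact: frf].
Qed.

Variables (C : fieldType) (X Y : affine C).
Hypothesis constX : forall c, coordinate (fun _ : affine_point X => c).
Hypothesis constY : forall c, coordinate (fun _ : affine_point Y => c).
Hypothesis mulX : forall f g : affine_point X -> C,
  coordinate f -> coordinate g -> coordinate (fun x => f x * g x).
Hypothesis mulY : forall f g : affine_point Y -> C,
  coordinate f -> coordinate g -> coordinate (fun y => f y * g y).
Local Notation XY := (affine_prod X Y).
Implicit Types f g : affine_point XY -> C.

Lemma coordinate_tensor (J : finType) (g : J -> affine_point X -> C)
    (h : J -> affine_point Y -> C) :
  (forall j, coordinate (g j)) -> (forall j, coordinate (h j)) ->
  @coordinate C XY (fun z => \sum_j g j z.1 * h j z.2).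
Proof.
move=> gX hY; exists #|J|, (g \o enum_val), (h \o enum_val); split=> [j|j|].
- exact: gX.
- exact: hY.
apply/funext => z; rewrite (reindex (@enum_val J J)) //.
exact/onW_bij/enum_val_bij.
Qed.

Lemma coordinate_fst (g : affine_point X -> C) : coordinate g ->
  @coordinate C XY (fun z => g z.1).
Proof.
move=> Hg; have -> : (fun z : affine_point XY => g z.1) =
    (fun z => \sum_(j : 'I_1) g z.1 * 1).
  by apply/funext => z; rewrite big_ord1 mulr1.
exact: (@coordinate_tensor 'I_1 (fun=> g) (fun _ _ => 1)).
Qed.

Lemma coordinate_snd (h : affine_point Y -> C) : coordinate h ->
  @coordinate C XY (fun z => h z.2).
Proof.
move=> Hh; have -> : (fun z : affine_point XY => h z.2) =
    (fun z => \sum_(j : 'I_1) 1 * h z.2).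
  by apply/funext => z; rewrite big_ord1 mul1r.
exact: (@coordinate_tensor 'I_1 (fun _ _ => 1) (fun=> h)).
Qed.

Lemma coordinateD f g : coordinate f -> coordinate g ->
  @coordinate C XY (fun z => f z + g z).
Proof.
move=> [r [f1 [f2 [Hf1 Hf2 ->]]]] [s [g1 [g2 [Hg1 Hg2 ->]]]].
pose h1 (j : 'I_r + 'I_s) := match j with inl i => f1 i | inr i => g1 i end.
pose h2 (j : 'I_r + 'I_s) := match j with inl i => f2 i | inr i => g2 i end.
have := @coordinate_tensor ('I_r + 'I_s)%type h1 h2; under eq_fun do rewrite big_sumType.
by apply; case.
Qed.

Lemma coordinateM f g : coordinate f -> coordinate g ->
  @coordinate C XY (fun z => f z * g z).
Proof.
move=> [r [f1 [f2 [Hf1 Hf2 ->]]]] [s [g1 [g2 [Hg1 Hg2 ->]]]].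
pose h1 (j : 'I_r * 'I_s) x := f1 j.1 x * g1 j.2 x.
pose h2 (j : 'I_r * 'I_s) y := f2 j.1 y * g2 j.2 y.
have := @coordinate_tensor ('I_r * 'I_s)%type h1 h2.
have -> : (fun z : affine_point XY => (\sum_j f1 j z.1 * f2 j z.2) *
    (\sum_j g1 j z.1 * g2 j z.2)) = fun z => \sum_j h1 j z.1 * h2 j z.2.
  apply/funext => z; rewrite big_distrlr pair_big.
  by apply: eq_bigr => j _; rewrite /h1 /h2 mulrACA.
by apply => j; [exact: mulX | exact: mulY].
Qed.

Lemma coordinate_sum (J : Type) (r : seq J) (f : J -> affine_point XY -> C) :
  (forall j, coordinate (f j)) -> @coordinate C XY (fun z => \sum_(j <- r) f j z).
Proof.
move=> Hf; elim: r => [|j r IH].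
  by under eq_fun do rewrite big_nil; apply: (coordinate_fst (g := fun=> 0)).
by under eq_fun do rewrite big_cons; apply: coordinateD.
Qed.

Lemma coordinate_prod (J : Type) (r : seq J) (P : pred J)
    (f : J -> affine_point XY -> C) :
  (forall j, coordinate (f j)) ->
  @coordinate C XY (fun z => \prod_(j <- r | P j) f j z).
Proof.
move=> Hf; elim: r => [|j r IH].
  by under eq_fun do rewrite big_nil; apply: (coordinate_fst (g := fun=> 1)).
under eq_fun do rewrite big_cons; case: (P j) => //; exact: coordinateM.
Qed.

End Morphisms.

(** * Regular functions on affine space *)

Section AffineSpace.
Variables (C : fieldType) (m : nat).

Lemma coordinate_space_cst c : @coordinate C (affine_space C m) (fun=> c).
Proof. by exists c%:MP; apply/funext => y; rewrite mevalC. Qed.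

Lemma coordinate_spaceM (f g : affine_point (affine_space C m) -> C) :
  coordinate f -> coordinate g -> @coordinate C (affine_space C m) (fun y => f y * g y).
Proof.
by move=> [F ->] [G ->]; exists (F * G); apply/funext => y; rewrite mevalM.
Qed.

End AffineSpace.

(** * Fractions with a power of one coordinate as denominator *)

Section HomogeneousFractions.
Local Open Scope classical_set_scope.
Variables (C : fieldType) (T : finType) (X : Type) (line : X -> {vspace {ffun T -> C^o}}).
Variable t0 : T.
Implicit Types (h : X -> C) (F : {mpoly C[#|T|]}).

(** [h] is the fraction [F / x^d], with [x] the coordinate at [t0], written without division and for
    every vector spanning the line. *)
Definition homogenizable h := exists d, exists2 F, F \is d.-homog &
  forall p v, <[v]>%VS = line p -> h p * v t0 ^+ d = peval F v.

Lemma eq_homogenizable h1 h2 : h1 =1 h2 -> homogenizable h2 -> homogenizable h1.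
Proof. by move/funext->. Qed.

Lemma homogenizable_cst c : homogenizable (fun=> c).
Proof.
exists 0%N, c%:MP; first by rewrite -[c%:MP]mulr1 mul_mpolyC dhomogZ ?dhomog1.
by move=> p v _; rewrite mulr1 /peval mevalC.
Qed.

Lemma homogenizableD h1 h2 : homogenizable h1 -> homogenizable h2 ->
  homogenizable (fun p => h1 p + h2 p).
Proof.
move=> [d1 [F1 F1d E1]] [d2 [F2 F2d E2]].
pose x := coord_var C t0; have xd d : x ^+ d \is d.-homog.
  by have := dhomogMn d (coord_var_homog C t0); rewrite mul1n.
exists (d1 + d2)%N, (F1 * x ^+ d2 + x ^+ d1 * F2).
  by rewrite rpredD // dhomogM.
move=> p v pv; rewrite /peval mevalD !mevalM !rmorphXn /= -!/(peval _ _).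
by rewrite peval_coord_var -(E1 p) // -(E2 p) // exprD; ring.
Qed.

Lemma homogenizableM h1 h2 : homogenizable h1 -> homogenizable h2 ->
  homogenizable (fun p => h1 p * h2 p).
Proof.
move=> [d1 [F1 F1d E1]] [d2 [F2 F2d E2]].
exists (d1 + d2)%N, (F1 * F2); first by rewrite dhomogM.
move=> p v pv; rewrite /peval mevalM -!/(peval _ _).
by rewrite -(E1 p) // -(E2 p) // exprD mulrACA.
Qed.

Lemma homogenizable_sum (J : Type) (r : seq J) (h : J -> X -> C) :
  (forall j, homogenizable (h j)) -> homogenizable (fun p => \sum_(j <- r) h j p).
Proof.
move=> Hh; elim: r => [|j r IH].
  by under eq_fun do rewrite big_nil; exact: homogenizable_cst.
by under eq_fun do rewrite big_cons; exact: homogenizableD.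
Qed.

Lemma homogenizable_prod (J : Type) (r : seq J) (P : pred J) (h : J -> X -> C) :
  (forall j, homogenizable (h j)) ->
  homogenizable (fun p => \prod_(j <- r | P j) h j p).
Proof.
move=> Hh; elim: r => [|j r IH].
  by under eq_fun do rewrite big_nil; exact: homogenizable_cst.
by under eq_fun do rewrite big_cons; case: (P j) => //; exact: homogenizableM.
Qed.

Lemma homogenizable_exp h q : homogenizable h -> homogenizable (fun p => h p ^+ q).
Proof.
move=> Hh; elim: q => [|q IH].
  by under eq_fun do rewrite expr0; exact: homogenizable_cst.
by under eq_fun do rewrite exprS; exact: homogenizableM.
Qed.

End HomogeneousFractions.

(** * The chart as a product *)

Section TangentialChart.
Local Open Scope classical_set_scope.
Variables (R : realType) (n : nat) (k : 'I_n -> nat).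
Hypotheses (n2 : (2 <= n)%N) (k1 : forall i, (1 <= k i)%N).
Variables (V : 'I_n -> vectType R[i]) (e : forall i, (k i).+1.-tuple (V i)).
Hypothesis e_basis : forall i, basis_of {: V i} (e i).
Local Notation C := R[i].
Local Notation MI := (multi_index k).
Local Notation MI0 := (multi_index0 k).
Local Notation E := {ffun MI -> C^o}.
Local Notation family := (forall i, 'I_(k i).+1 -> C).
Local Notation W := (tangential_variety (segre e) `&` chart MI0).
Local Notation X := {p : {vspace E} | \dim p = 1%N /\ W p}.
Local Notation Spec_point := {lrmorphism Q_algebra R k -> C^o}.
Local Notation A := {ffun 'I_(\sum_(i < n) k i) -> C}.
Implicit Types (I J : MI) (p : X) (y : A) (phi : Spec_point) (z : E).

Let n0 : (0 < n)%N := ltnW n2.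

Lemma weight_eq0 I : weight I = 0%N -> I = MI0.
Proof.
move=> /card0_eq I0; apply/ffunP => i; rewrite ffunE; apply/eqP.
by have := I0 i; rewrite inE => /negbFE.
Qed.

Lemma weight_eq1 I : weight I = 1%N ->
  exists i, exists2 j : 'I_(k i).+1, j != ord0 & I = upd MI0 j.
Proof.
move=> I1; have [|i _ Ii] := @weight_notin _ _ I finset.set0.
  by rewrite cards0 I1.
exists i, (I i) => //; apply/ffunP => l; have [<-|il] := eqVneq i l.
  by rewrite upd_in.
rewrite upd_out // ffunE; apply/eqP/negPn/negP => Il.
have := @weight_ge _ _ I [:: i; l]; rewrite /= !inE il Ii Il I1.
by move=> /(_ isT isT).
Qed.

(** The factor [1 - |I|] is 1 at (0,...,0) and 0 in weight 1, which makes the tensor centred; it is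
    nonzero in higher weights, so [phi] can be recovered. *)
Definition toric phi : E :=
  [ffun I => (1 - (weight I)%:R) * value phi (generator R I) : C].

Lemma centred_toric phi : centred (toric phi).
Proof.
split=> [|i j j0]; rewrite ffunE; last by rewrite weight1 // subrr mul0r.
rewrite weight0 subr0 mul1r /generator; case: pselect => /=.
  by move=> W2; exfalso; rewrite weight0 in W2.
by move=> _; rewrite value0.
Qed.

Lemma centred_inj z z' : centred z -> centred z' ->
  (forall I, (1 < weight I)%N -> z I = z' I) -> z = z'.
Proof.
move=> [z0 z1] [z0' z1'] zz; apply/ffunP => I.
have [|wI] := ltnP 1 (weight I); first exact: zz.
have [/weight_eq0->|wI0] := eqVneq (weight I) 0%N; first by rewrite z0 z0'.
have [|i [j j0 ->]] := @weight_eq1 I; last by rewrite z1 ?z1'.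
by apply/eqP; rewrite eqn_leq wI lt0n.
Qed.

(** The normal form of centred tangent vectors gives one direction, the classification of monoid
    morphisms on the vertices the other. *)
Lemma toricP z : centred z ->
  (exists a b, nonzero_family a /\ z = tangent_vector a b) <->
  exists phi, z = toric phi.
Proof.
move=> cz; split=> [[a [b [_ zE]]]|[phi zE]].
  have [|o [c [c0 zc]]] := @tangent_vector_monomial _ _ _ a b; first by rewrite -zE.
  have [phi phiE] := monomial_value_Spec_point o c0.
  exists phi; apply: centred_inj cz (centred_toric phi) _ => I I2.
  by rewrite zE zc // ffunE phiE.
have [o [c [c0 oc cE]]] := monomial_value_of_multiplicative (value_multiplicative phi).
have [a [b [a0 cab ab]]] := monomial_tangent_vector n0 c0 oc.
exists a, b; split=> //; apply: centred_inj => // I I2.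
by rewrite zE ffunE cE // ab.
Qed.

Lemma toric_inj : injective toric.
Proof.
move=> phi psi toricE; apply: value_inj => I I2.
have := congr1 (fun z : E => z I) toricE; rewrite !ffunE; apply: mulfI.
by rewrite subr_eq0 eq_sym (eqr_nat _ _ 1) neq_ltn I2 orbT.
Qed.

Lemma shear_nonzero_family (x a : family) : nonzero_family a ->
  nonzero_family (fun i j => offzero x j * a i ord0 + a i j).
Proof.
move=> a0 i; have [j aj] := a0 i; have [ai|ai] := eqVneq (a i ord0) 0.
  by exists j; rewrite ai mulr0 add0r.
by exists ord0; rewrite /offzero eqxx mul0r add0r.
Qed.

(** [tagnat.Rank] numbers the pairs (i, l) by the coordinates of the affine space; the value at
    [ord0] is a default that [offzero] overrides. *)
Definition family_of y : family :=
  fun i j => if unlift ord0 j is Some l then y (tagnat.Rank i l) else 0.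

Definition opp_family (x : family) : family := fun i j => - x i j.

(** The inverse of passing to cumulants: the affine coordinates are put back as the means. *)
Definition embed (x : Spec_point * A) : E := shear (family_of x.2) (toric x.1).

Lemma embed0 x : embed x MI0 = 1.
Proof. by rewrite /embed shear0; have [] := centred_toric x.1. Qed.

Lemma embed_dim x : \dim <[embed x]>%VS = 1%N.
Proof.
rewrite dim_vline; case: eqVneq => // /(congr1 (fun u : E => u MI0)).
by rewrite embed0 ffunE => /eqP; rewrite oner_eq0.
Qed.

Lemma embed_line x v : <[v]>%VS = <[embed x]>%VS ->
  v = (v MI0 : C) *: embed x /\ v MI0 != 0.
Proof.
move=> vx; have /vlineP[c vE] : v \in <[embed x]>%VS by rewrite -vx memv_line.
have cE : v MI0 = c by rewrite vE ffunE embed0 [LHS]mulr1.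
rewrite cE; split=> //; apply/eqP => c0; move: (embed_dim x).
by rewrite -vx vE c0 scale0r dim_vline eqxx.
Qed.

Lemma embed_W x : W <[embed x]>%VS.
Proof.
split; last by move=> v /embed_line[].
have [a [b [a0 ab]]] := (toricP (centred_toric x.1)).2 (ex_intro _ x.1 erefl).
have := embed_dim x; rewrite /embed ab shear_tangent dim_vline => u1.
apply: tangent_vector_tangential => //; first exact: shear_nonzero_family.
by move: u1; case: eqVneq.
Qed.

Definition to_line (x : Spec_point * A) : X :=
  exist _ <[embed x]>%VS (conj (embed_dim x) (embed_W x)).

Lemma representative_subproof p : exists u : E, <[u]>%VS = sval p /\ u MI0 = 1.
Proof.
case: p => p /= [p1 [_ p0]].
have pE : <[vpick p]>%VS = p.
  apply/eqP; rewrite eqEdim -memvE memv_pick p1 dim_vline.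
  by rewrite vpick0 -dimv_eq0 p1.
have c0 := p0 _ pE; exists ((vpick p MI0 : C)^-1 *: vpick p).
by rewrite vlineN0 ?invr_eq0 // ffunE [_ *: _]mulVf.
Qed.

Definition representative p : E := sval (cid (representative_subproof p)).

Lemma representative_line p : <[representative p]>%VS = sval p.
Proof. by rewrite /representative; case: cid => u []. Qed.

Lemma representative0 p : representative p MI0 = 1.
Proof. by rewrite /representative; case: cid => u []. Qed.

Lemma line_neq0 p v : <[v]>%VS = sval p -> v MI0 != 0.
Proof. by move: (svalP p) => [_ [_]]; apply. Qed.

Lemma line_representative p v : <[v]>%VS = sval p ->
  v = (v MI0 : C) *: representative p.
Proof.
move=> vp; have /vlineP[c vE] : v \in <[representative p]>%VS.
  by rewrite representative_line -vp memv_line.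
rewrite {1}vE; congr (_ *: _); rewrite vE ffunE representative0.
exact: esym (mulr1 c).
Qed.

Definition means p : A :=
  [ffun s => representative p (upd MI0 (lift ord0 (tagged (tagnat.sig s))))].

Lemma family_ofE y i (l : 'I_(k i)) :
  family_of y (lift ord0 l) = y (tagnat.Rank i l).
Proof. by rewrite /family_of liftK. Qed.

Lemma family_of_means p i (j : 'I_(k i).+1) : j != ord0 ->
  family_of (means p) j = representative p (upd MI0 j).
Proof.
by case: (unliftP ord0 j) => [l ->|->]; rewrite ?eqxx // family_ofE ffunE tagnat.rankK.
Qed.

(** The passage to cumulants: subtracting the means kills the coordinates of weight 1. *)
Definition centre p : E :=
  shear (opp_family (family_of (means p))) (representative p).

Lemma centre_toric p : exists phi, centre p = toric phi.
Proof.
apply/toricP.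
  split=> [|i j j0]; first by rewrite shear0 representative0.
  by rewrite shear1 // representative0 mulr1 /opp_family family_of_means // subrr.
have [a [b [a0 pE]]] := tangential_tangent_vector e_basis n0 (svalP p).2.1.
have /vlineP[c uE] : representative p \in <[tangent_vector a b]>%VS.
  by rewrite -pE -representative_line memv_line.
(* The scalar [c] is absorbed into [b], so the normalised representative is itself a tangent
   vector. *)
rewrite /centre uE -tangent_vectorZ shear_tangent.
by do 2!eexists; split; last reflexivity; exact: shear_nonzero_family.
Qed.

Definition of_line p : Spec_point * A := (sval (cid (centre_toric p)), means p).

Lemma toric_of_line p : toric (of_line p).1 = centre p.
Proof. by rewrite /of_line /=; case: cid. Qed.

Lemma embed_of_line p : embed (of_line p) = representative p.
Proof.
by rewrite /embed toric_of_line; apply: shearK => i j.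
Qed.

Lemma of_lineK : cancel of_line to_line.
Proof.
move=> p; case: p (embed_of_line p) (representative_line p) => p Hp ep rp.
by apply: eq_exist; rewrite ep.
Qed.

Lemma representative_to_line x : representative (to_line x) = embed x.
Proof.
have := @line_representative (to_line x) (embed x) erefl.
by rewrite embed0 scale1r.
Qed.

Lemma means_to_line x : means (to_line x) = x.2.
Proof.
apply/ffunP => s; rewrite ffunE representative_to_line.
have [z0 z1] := centred_toric x.1.
rewrite /embed shear1 1?eq_sym ?neq_lift // z1 1?eq_sym ?neq_lift //.
rewrite z0 mulr1 add0r family_ofE; congr (x.2 _).
by rewrite /tagnat.Rank -[RHS]tagnat.sigK; case: (tagnat.sig s).
Qed.

Lemma to_lineK : cancel to_line of_line.
Proof.
move=> x; have x2 : (of_line (to_line x)).2 = x.2 by exact: means_to_line.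
have x1 : (of_line (to_line x)).1 = x.1.
  apply: toric_inj; rewrite toric_of_line /centre means_to_line.
  rewrite representative_to_line; apply: shearK => i j.
  by rewrite /opp_family opprK.
apply: etrans (surjective_pairing _) _.
exact: etrans (congr2 pair x1 x2) (esym (surjective_pairing x)).
Qed.

Local Notation homogenizable := (@homogenizable C {: MI} X sval MI0).

Lemma homogenizable_representative I :
  homogenizable (fun p => representative p I).
Proof.
exists 1%N, (coord_var C I); first exact: coord_var_homog.
move=> p v vp; rewrite peval_coord_var expr1 mulrC.
by rewrite {2}(line_representative vp) ffunE.
Qed.

Lemma homogenizable_centre I : homogenizable (fun p => centre p I).
Proof.
have centreE p : centre p I = \sum_(S : {set 'I_n})
    (\prod_(i in S) offzero (opp_family (family_of (means p))) (I i)) *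
    representative p (cutoff S I) :> C by rewrite ffunE.
apply: (eq_homogenizable centreE).
apply: homogenizable_sum => S; apply: homogenizableM.
  apply: homogenizable_prod => i; rewrite /offzero.
  have [_|Ii] := eqVneq (I i) ord0; first exact: homogenizable_cst.
  apply: (@eq_homogenizable _ _ _ _ _ _
    (fun p => -1 * representative p (upd MI0 (I i)))) => [p|].
    by rewrite /opp_family family_of_means // mulN1r.
  by apply: homogenizableM (homogenizable_representative _); exact: homogenizable_cst.
exact: homogenizable_representative.
Qed.

(** On generators [value] is a coordinate of [centre] divided by the nonzero number [1 - |I|];
    products reach the whole monoid. *)
Lemma homogenizable_value x : homogenizable (fun p => value (of_line p).1 x).
Proof.
elim/Q_monoid_ind: x => [|x1 x2 H1 H2|I I2].
- apply: (eq_homogenizable (fun p => value0 _)); exact: homogenizable_cst.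
- exact: eq_homogenizable (fun p => valueD _ _ _) (homogenizableM H1 H2).
have w0 : 1 - (weight I)%:R != 0 :> C.
  by rewrite subr_eq0 eq_sym (eqr_nat _ _ 1) neq_ltn I2 orbT.
have E p : value (of_line p).1 (generator R I) =
    (1 - (weight I)%:R)^-1 * centre p I.
  by rewrite -toric_of_line ffunE mulKf.
apply: (eq_homogenizable E); apply: homogenizableM (homogenizable_centre I).
exact: homogenizable_cst.
Qed.

Lemma homogenizable_coordinate
    (g : affine_point (affine_prod (Spec (Q_algebra R k)) (affine_space C _)) -> C) :
  coordinate g -> homogenizable (fun p => g (of_line p)).
Proof.
move=> [r [f [h [fS hA ->]]]]; apply: homogenizable_sum => j.
apply: homogenizableM; last first.
  have [F ->] := hA j; apply: (eq_homogenizable (fun p => mevalE _ _)).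
  apply: homogenizable_sum => m; apply: homogenizableM; first exact: homogenizable_cst.
  apply: homogenizable_prod => s; apply: homogenizable_exp.
  apply: (eq_homogenizable (fun p => ffunE _ _)); exact: homogenizable_representative.
have [a ->] := fS j; have [s [c ->]] := Q_algebra_sum a.
apply: (eq_homogenizable (fun p => Spec_point_sum _ _ _)).
apply: homogenizable_sum => x; apply: homogenizableM; first exact: homogenizable_cst.
exact: homogenizable_value.
Qed.

Local Notation Y :=
  (affine_prod (Spec (Q_algebra R k)) (affine_space C (\sum_(i < n) k i))).

Lemma of_line_morphism :
  @is_morphism C (quasi_projective W) (affine_variety Y) of_line.
Proof.
apply: locally_fractional_morphism => [_ [g /homogenizable_coordinate[d [F Fd FE]] ->]|].
  exists d, F => //; apply/seteqP; split=> p /=.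
    by move=> gp v vp; rewrite -(FE p) // mulf_neq0 // expf_neq0 // (line_neq0 vp).
  move=> /(_ _ (representative_line p)); rewrite -(FE p) ?representative_line //.
  by rewrite mulf_eq0 negb_or => /andP[].
move=> N h [g1 [g2 [/homogenizable_coordinate[d1 [F1 F1d F1E]]]]].
move=> /homogenizable_coordinate[d2 [F2 F2d F2E]] hE.
pose x := coord_var C MI0.
have xd d : x ^+ d \is d.-homog.
  by have := dhomogMn d (coord_var_homog C MI0); rewrite mul1n.
(* The quotient of [F1 / x^d1] by [F2 / x^d2], with numerator and denominator of equal degree. *)
exists (d1 + d2)%N, (F1 * x ^+ d2), (x ^+ d1 * F2); split; try exact: dhomogM.
move=> p v Np vp; have v0 := line_neq0 vp; have [g20 hpE] := hE _ Np.
rewrite /peval !mevalM !rmorphXn /= -!/(peval _ _) !peval_coord_var.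
rewrite -(F1E p) // -(F2E p) //; split.
  by rewrite !mulf_neq0 ?expf_neq0.
rewrite /= hpE; apply/eqP; rewrite eqr_div ?mulf_neq0 ?expf_neq0 //.
by apply/eqP; ring.
Qed.

Local Notation regular_on_product := (@coordinate C Y).

Lemma coordinate_YM f g : regular_on_product f -> regular_on_product g ->
  regular_on_product (fun x => f x * g x).
Proof.
exact: (coordinateM (@coordinate_SpecM R n k) (@coordinate_spaceM C _)).
Qed.

Lemma coordinate_Y_cst c : regular_on_product (fun=> c).
Proof.
exact: (coordinate_fst (@coordinate_space_cst C _)
  (g := fun=> c) (coordinate_Spec_cst k c)).
Qed.

Lemma coordinate_Y_sum (J : Type) (r : seq J) f :
  (forall j, regular_on_product (f j)) ->
  regular_on_product (fun x => \sum_(j <- r) f j x).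
Proof.
exact: (coordinate_sum (@coordinate_Spec_cst R n k) (@coordinate_space_cst C _)).
Qed.

Lemma coordinate_Y_prod (J : Type) (r : seq J) (P : pred J) f :
  (forall j, regular_on_product (f j)) ->
  regular_on_product (fun x => \prod_(j <- r | P j) f j x).
Proof.
exact: (coordinate_prod (@coordinate_Spec_cst R n k) (@coordinate_space_cst C _)
  (@coordinate_SpecM R n k) (@coordinate_spaceM C _)).
Qed.

(** By the formula for [shear], a polynomial in the affine coordinates with multiples of values of
    the spectrum point as coefficients. *)
Lemma coordinate_embed I : regular_on_product (fun x => embed x I).
Proof.
have -> : (fun x => embed x I) = (fun x => \sum_(S : {set 'I_n})
    (\prod_(i in S) offzero (family_of x.2) (I i)) *
    ((1 - (weight (cutoff S I))%:R) * value x.1 (generator R (cutoff S I)))).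
  by apply/funext => x; rewrite ffunE; apply: eq_bigr => S _; rewrite ffunE.
apply: coordinate_Y_sum => S; apply: coordinate_YM; last first.
  exact: (coordinate_fst (@coordinate_space_cst C _) (coordinate_value _ _)).
apply: coordinate_Y_prod => i; rewrite /offzero.
case: (unliftP ord0 (I i)) => [l ->|->]; last first.
  by rewrite eqxx; exact: coordinate_Y_cst.
rewrite eq_sym (negPf (neq_lift _ _)) /family_of liftK.
have coordX : @coordinate C (affine_space C _) (fun y : A => y (tagnat.Rank i l)).
  by exists 'X_(tagnat.Rank i l); apply/funext => y; rewrite mevalXU.
exact: (coordinate_snd (@coordinate_Spec_cst R n k) coordX).
Qed.

Lemma coordinate_peval_embed (G : {mpoly C[#|{: MI}|]}) :
  regular_on_product (fun x => peval G (embed x)).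
Proof.
have -> : (fun x => peval G (embed x)) = (fun x => \sum_(m <- msupp G)
    G@_m * \prod_i embed x (enum_val i) ^+ m i).
  by apply/funext => x; rewrite /peval mevalE.
apply: coordinate_Y_sum => m; apply: coordinate_YM; first exact: coordinate_Y_cst.
apply: coordinate_Y_prod => i; elim: (m i) => [|q IH].
  exact: coordinate_Y_cst.
have -> : (fun x => embed x (enum_val i) ^+ q.+1) =
    (fun x => (embed x (enum_val i) : C) * embed x (enum_val i) ^+ q).
  by apply/funext => x; rewrite exprS.
exact: coordinate_YM (coordinate_embed _) IH.
Qed.

Lemma to_line_morphism :
  @is_morphism C (affine_variety Y) (quasi_projective W) to_line.
Proof.
apply: locally_fractional_morphism => [_ [d [G Gd ->]]|N h [d [F [G [Fd Gd hE]]]]].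
  (* [embed x] spans the line and has regular coordinates; homogeneity makes nonvanishing
     independent of the spanning vector. *)
  exists (fun x => peval G (embed x)); first exact: coordinate_peval_embed.
  apply/seteqP; split=> x /=; first by apply.
  move=> Gx v /embed_line[vE v0]; rewrite vE (peval_homog _ _ Gd).
  exact: mulf_neq0 (expf_neq0 _ v0) Gx.
exists (fun x => peval F (embed x)), (fun x => peval G (embed x)); split.
- exact: coordinate_peval_embed.
- exact: coordinate_peval_embed.
- by move=> x Nx; apply: hE Nx _.
Qed.

Lemma isomorphic_tangential_chart :
  isomorphic (quasi_projective W) (affine_variety Y).
Proof.
exists of_line, to_line; split.
- exact: of_line_morphism.
- exact: to_line_morphism.
- exact: of_lineK.
- exact: to_lineK.
Qed.

End TangentialChart.

Local Open Scope classical_set_scope.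

Theorem proposition8p1 (R : realType) (n : nat) (hn : (2 <= n)%N)
    (k : 'I_n -> nat) (hk : forall i, (1 <= k i)%N)
    (V : 'I_n -> vectType R[i])
    (hV : forall i, \dim {: V i} = (k i).+1)
    (e : forall i, (k i).+1.-tuple (V i))
    (he : forall i, basis_of {: V i} (e i)) :
  isomorphic
    (quasi_projective
       (tangential_variety (segre e) `&` chart (multi_index0 k)))
    (affine_variety
       (affine_prod (Spec (Q_algebra R k))
                    (affine_space R[i] (\sum_(i < n) k i)))).
Proof. exact: isomorphic_tangential_chart. Qed.
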